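(* Let $A$ be a commutative ring, $E$ an $A$-module, and $R = A\ltimes E$ the trivial ring extension of $A$ by $E$. Suppose that $\mathrm{G\text{-}gldim}(A)$ is finite and $\mathrm{fd}_A(E)=r$ for some integer $r\geq 0$. Then $$\mathrm{G\text{-}gldim}(A)\leq \mathrm{G\text{-}gldim}(R)+r.$$
   Context: All rings are commutative with identity and all modules are unital. $\mathrm{fd}$ denotes flat dimension. The trivial ring extension $A\ltimes E$ of a ring $A$ by an $A$-module $E$ is the ring with underlying additive group $A\times E$ and multiplication $(a,e)(a',e')=(aa',ae'+a'e)$. Let $S$ be a ring. An $S$-module $N$ is Gorenstein projective if there is an exact complex $\cdots\to P_1\to P_0\to P^0\to P^1\to\cdots$ of projective $S$-modules with $N\cong\mathrm{Im}(P_0\to P^0)$ that remains exact after applying $\mathrm{Hom}_S(-,Q)$ for every projective $S$-module $Q$. The Gorenstein projective dimension $\mathrm{Gpd}_S(N)$ is the least $n\geq 0$ such that there is an exact sequence $0\to G_n\to\cdots\to G_0\to N\to 0$ with all $G_i$ Gorenstein projective ($\infty$ if there is none). The Gorenstein global dimension of $S$ is $\mathrm{G\text{-}gldim}(S)=\sup\{\mathrm{Gpd}_S(N)\mid N\text{ an }S\text{-module}\}\in\{0,1,2,\dots\}\cup\{\infty\}$. *)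

(* Defs.v *)
From HB Require Import structures.
From mathcomp Require Import all_boot all_order all_algebra generic_quotient.
From mathcomp Require Import boolp classical_sets constructive_ereal.

Set Implicit Arguments.
Unset Strict Implicit.
Unset Printing Implicit Defensive.

Import Order.TTheory GRing.Theory Num.Theory.

Local Open Scope classical_set_scope.
Local Open Scope quotient_scope.
Local Open Scope ring_scope.

(* Rings are [comPzRingType]s, so that the zero ring is allowed, as in the
   convention "commutative ring with identity". *)

Section TrivialExtension.
Variables (A : comPzRingType) (E : lmodType A).

Definition trivext : Type := (A * E)%type.

HB.instance Definition _ := GRing.Zmodule.copy trivext (A * E)%type.

Definition trivext_one : trivext := (1, 0).
Definition trivext_mul (x y : trivext) : trivext :=
  (x.1 * y.1, x.1 *: y.2 + y.1 *: x.2).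

Fact trivext_mulA : associative trivext_mul.
Proof.
move=> [a e] [b f] [c g]; rewrite /trivext_mul /= mulrA; congr pair.
by rewrite !scalerDr !scalerA addrA (mulrC c a) (mulrC c b).
Qed.

Fact trivext_mulC : commutative trivext_mul.
Proof. by move=> [a e] [b f]; rewrite /trivext_mul /= mulrC addrC. Qed.

Fact trivext_mul1 : left_id trivext_one trivext_mul.
Proof. by move=> [a e]; rewrite /trivext_mul /= mul1r scale1r scaler0 addr0. Qed.

Fact trivext_mulDl : left_distributive trivext_mul +%R.
Proof.
move=> [a e] [b f] [c g]; rewrite /trivext_mul /=; congr pair => /=.
  by rewrite mulrDl.
by rewrite scalerDl scalerDr addrACA.
Qed.

HB.instance Definition _ := GRing.Zmodule_isComPzRing.Build trivext
  trivext_mulA trivext_mulC trivext_mul1 trivext_mulDl.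

End TrivialExtension.

Section Tensor.
Variable A : comPzRingType.
Implicit Types M N P : lmodType A.

Definition bilin M N P (b : M -> N -> P) : Prop :=
  (forall x, linear (b x)) /\ (forall y, linear (b^~ y)).

(* The tensor product is the set of formal sums of pairs, two of them being
   identified when every bilinear map takes the same value on both. *)
Section Construction.
Variables M N : lmodType A.

Definition fsum_eval P (b : M -> N -> P) (s : seq (M * N)) : P :=
  \sum_(p <- s) b p.1 p.2.

Definition tens_rel (s t : seq (M * N)) : bool :=
  `[< forall P (b : M -> N -> P), bilin b -> fsum_eval b s = fsum_eval b t >].

Fact tens_rel_equiv : equiv_class_of tens_rel.
Proof.
split=> [s|s t|t s u].
- by apply/asboolP.
- by apply/asboolP/asboolP => h P b bb; rewrite h.
- by move=> /asboolP h1 /asboolP h2; apply/asboolP => P b bb; rewrite h1 ?h2.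
Qed.

Canonical tens_equiv_rel := EquivRelPack tens_rel_equiv.

Definition tens : Type := {eq_quot tens_rel}.

HB.instance Definition _ := Choice.on tens.
HB.instance Definition _ := EqQuotient.on tens.

Fact tens_eqP (s t : seq (M * N)) :
  (forall P (b : M -> N -> P), bilin b -> fsum_eval b s = fsum_eval b t) <->
  \pi_tens s = \pi_tens t.
Proof.
split=> [h|/eqquotP/asboolP //]; apply/eqquotP; exact/asboolP.
Qed.

Definition tens_val P (b : M -> N -> P) (t : tens) : P := fsum_eval b (repr t).

Fact tens_valE P (b : M -> N -> P) : bilin b ->
  forall s, tens_val b (\pi_tens s) = fsum_eval b s.
Proof. by move=> bb s; apply: (tens_eqP _ _).2 => //; rewrite reprK. Qed.

Fact tens_inj (t u : tens) :
  (forall P (b : M -> N -> P), bilin b -> tens_val b t = tens_val b u) -> t = u.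
Proof. by move=> h; rewrite -(reprK t) -(reprK u); apply/tens_eqP. Qed.

Definition tens_zero : tens := \pi_tens [::].
Definition tens_add (t u : tens) : tens := \pi_tens (repr t ++ repr u).
Definition tens_scale (a : A) (t : tens) : tens :=
  \pi_tens [seq (a *: p.1, p.2) | p <- repr t].
Definition tens_opp (t : tens) : tens := tens_scale (-1) t.

Fact tens_val0 P (b : M -> N -> P) : bilin b -> tens_val b tens_zero = 0.
Proof. by move=> bb; rewrite tens_valE // /fsum_eval big_nil. Qed.

Fact tens_valD P (b : M -> N -> P) : bilin b ->
  forall t u, tens_val b (tens_add t u) = tens_val b t + tens_val b u.
Proof. by move=> bb t u; rewrite tens_valE // /fsum_eval big_cat. Qed.

Fact tens_valZ P (b : M -> N -> P) : bilin b ->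
  forall a t, tens_val b (tens_scale a t) = a *: tens_val b t.
Proof.
move=> bb a t; rewrite tens_valE // /tens_val /fsum_eval big_map scaler_sumr.
apply: eq_bigr => -[x y] _ /=; exact: scalable_linear (bb.2 y) a x.
Qed.

Fact tens_addA : associative tens_add.
Proof.
by move=> t u v; apply: tens_inj => P b bb; rewrite !tens_valD // addrA.
Qed.

Fact tens_addC : commutative tens_add.
Proof. by move=> t u; apply: tens_inj => P b bb; rewrite !tens_valD // addrC. Qed.

Fact tens_add0 : left_id tens_zero tens_add.
Proof.
by move=> t; apply: tens_inj => P b bb; rewrite tens_valD // tens_val0 // add0r.
Qed.

Fact tens_addN : left_inverse tens_zero tens_opp tens_add.
Proof.
move=> t; apply: tens_inj => P b bb.
by rewrite tens_valD // tens_valZ // tens_val0 // scaleN1r addNr.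
Qed.

HB.instance Definition _ :=
  GRing.isZmodule.Build tens tens_addA tens_addC tens_add0 tens_addN.

Fact tens_scaleA a b (t : tens) :
  tens_scale a (tens_scale b t) = tens_scale (a * b) t.
Proof. by apply: tens_inj => P f ff; rewrite !tens_valZ // scalerA. Qed.

Fact tens_scale1 : left_id 1 tens_scale.
Proof. by move=> t; apply: tens_inj => P f ff; rewrite tens_valZ // scale1r. Qed.

Fact tens_scaleDr : right_distributive tens_scale +%R.
Proof.
move=> a t u; apply: tens_inj => P f ff.
by rewrite tens_valZ // !tens_valD // !tens_valZ // scalerDr.
Qed.

Fact tens_scaleDl (t : tens) : {morph tens_scale^~ t : a b / a + b}.
Proof.
move=> a b; apply: tens_inj => P f ff.
by rewrite tens_valD // !tens_valZ // scalerDl.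
Qed.

HB.instance Definition _ := GRing.Zmodule_isLmodule.Build A tens
  tens_scaleA tens_scale1 tens_scaleDr tens_scaleDl.

Definition pure (x : M) (y : N) : tens := \pi_tens [:: (x, y)].

Fact tens_val_pure P (b : M -> N -> P) : bilin b ->
  forall x y, tens_val b (pure x y) = b x y.
Proof. by move=> bb x y; rewrite tens_valE // /fsum_eval big_seq1. Qed.

Fact pure_bilin : bilin pure.
Proof.
split=> [x|y] a u v; apply: tens_inj => P b bb;
  rewrite tens_valD // tens_valZ // !tens_val_pure //.
- exact: bb.1.
- exact: bb.2.
Qed.

Fact tens_val_linear P (b : M -> N -> P) : bilin b -> linear (tens_val b).
Proof. by move=> bb a t u; rewrite tens_valD // tens_valZ. Qed.

Fact tens_sum_pure (t : tens) : t = \sum_(p <- repr t) pure p.1 p.2.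
Proof.
rewrite -{1}(reprK t); elim: (repr t) => [|[x y] s IHs]; first by rewrite big_nil.
rewrite big_cons -IHs; apply: tens_inj => P b bb.
by rewrite tens_valD // !tens_valE // /fsum_eval !big_cons big_nil addr0.
Qed.

Fact tens_universal P (b : M -> N -> P) : bilin b ->
  exists f : {linear tens -> P}, (forall x y, f (pure x y) = b x y) /\
    forall g : {linear tens -> P}, (forall x y, g (pure x y) = b x y) -> g =1 f.
Proof.
move=> bb.
pose m := GRing.isLinear.Build A tens P *:%R (tens_val b) (tens_val_linear bb).
pose f : {linear tens -> P} := HB.pack (tens_val b) m.
exists f; split=> [x y|g gE t]; first exact: tens_val_pure.
rewrite (tens_sum_pure t) !linear_sum; apply: eq_bigr => -[x y] _ /=.
by rewrite gE tens_val_pure.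
Qed.

End Construction.

Definition tens_map M M' N (f : {linear M -> M'}) : tens M N -> tens M' N :=
  tens_val (fun x y => pure (f x) y).
Arguments tens_map {M M'} N f.

(* Makes [tens_map] meaningful: [tens_val] is only relevant on bilinear maps. *)
Fact tens_map_bilin M M' N (f : {linear M -> M'}) :
  bilin (fun x (y : N) => pure (f x) y).
Proof.
split=> [x|y] a u v; first exact: (pure_bilin _ _).1.
by rewrite linearP; apply: (pure_bilin _ _).2.
Qed.

Definition flat N : Prop :=
  forall M M' (f : {linear M -> M'}), injective f -> injective (tens_map N f).

End Tensor.

Section Dimensions.
Variable S : comPzRingType.

Definition projective (P : lmodType S) : Prop :=
  forall (M N : lmodType S) (g : {linear M -> N}) (f : {linear P -> N}),
    (forall y, exists x, g x = y) ->
    exists h : {linear P -> M}, forall p, g (h p) = f p.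

(* A complex is written homologically and indexed by [int], so that P^j is
   [P (- 1 - j)]; [d i] maps degree [i + 1] to degree [i]. *)
Definition gproj (N : lmodType S) : Prop :=
  exists (P : int -> lmodType S) (d : forall i, {linear P (i + 1) -> P i}),
  [/\ forall i, projective (P i),
      forall i (x : P (i + 1)), d i x = 0 <-> exists y, d (i + 1) y = x,
      forall (Q : lmodType S), projective Q ->
        forall i (f : {linear P (i + 1) -> Q}),
          (forall y, f (d (i + 1) y) = 0) <->
          exists g : {linear P i -> Q}, forall x, f x = g (d i x)
    & exists phi : {linear N -> P (-1)}, injective phi /\
        forall z, (exists n, phi n = z) <-> (exists x, d (-1) x = z)].

(* An exact sequence 0 -> G_n -> ... -> G_0 -> N -> 0 with all G_i in X,
   extended by zero modules in degrees above n. *)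
Definition has_resolution (X : lmodType S -> Prop) (N : lmodType S) (n : nat) :
    Prop :=
  exists (G : nat -> lmodType S) (d : forall i, {linear G i.+1 -> G i})
         (eps : {linear G 0%N -> N}),
  [/\ forall i, (i <= n)%N -> X (G i),
      forall i, (n < i)%N -> forall x : G i, x = 0,
      forall z, exists x, eps x = z,
      forall x, eps x = 0 <-> exists y, d 0%N y = x
    & forall i (x : G i.+1), d i x = 0 <-> exists y, d i.+1 y = x].

(* The least n such that there is a resolution of length n, +oo if none. *)
Definition resdim (X : lmodType S -> Prop) (N : lmodType S) : \bar int :=
  infimum +oo%E [set x | exists2 n : nat, has_resolution X N n & x = n%:Z%:E].

Definition fd (N : lmodType S) : \bar int := resdim (@flat S) N.

Definition Gpd (N : lmodType S) : \bar int := resdim gproj N.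

Definition Ggldim : \bar int :=
  supremum 0%E [set x | exists N : lmodType S, x = Gpd N].

End Dimensions.

(* Main.v *)
From HB Require Import structures.
Require Import Defs.
From mathcomp Require Import all_boot all_order all_algebra generic_quotient.
From mathcomp Require Import boolp classical_sets functions constructive_ereal.

(* Let n = G-gldim(R), assumed finite, and let K be an r-th syzygy of an
   A-module M. Since fd E = r, Tor^A_i(K, E) = 0 for i > 0, so - (x)_A R sends
   a projective resolution of K to an R-projective resolution of K (x)_A R. For
   Q projective over A, Hom_R(- (x) R, Q (x) R) = Hom_A(-, Q (x) R) contains
   Hom_A(-, Q) as a direct summand, and Ext_R^i(K (x) R, Q (x) R) = 0 for i > n
   because Q (x) R is R-projective. Hence the n-th syzygy of K, which is an
   (r+n)-th syzygy of M, has no higher Ext into projectives; as it has finite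
   Gorenstein projective dimension, it is Gorenstein projective. *)

Set Implicit Arguments.
Unset Strict Implicit.
Unset Printing Implicit Defensive.

Import Order.TTheory GRing.Theory Num.Theory.

Local Open Scope ring_scope.

(** * Linear maps, submodules, quotients and short exact sequences *)

Section Modules.
Variable S : comPzRingType.
Implicit Types K L M N P Q : lmodType S.

(** Ext and Tor are never built as groups. Only their vanishing is needed, expressed by [ext_van]
    and [tor_van], which range over all short exact sequences ending in the given module. Passing to
    a syzygy is then mere unfolding; what has to be proved for Ext is that one presentation suffices
    and that vanishing propagates along short exact sequences. For Tor, the syzygies are taken in
    the module K, while the flat resolution is one of E: a dimension shift trades a step in one
    variable for a step in the other. The obstacle is the last step. Vanishing of Ext into
    projectives controls syzygies, that is the left half of a complete resolution; the right half
    must be produced. It is carried up along a finite resolution by Gorenstein projectives, which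
    exists because G-gldim(A) is finite. To keep this manageable, Gorenstein projectivity is handled
    as membership in a class of Ext-acyclic modules closed under some cosyzygy, and integer-indexed
    complexes occur only in the translation to and from [gproj]. *)

Definition mklin M N (f : M -> N) (fl : linear f) : {linear M -> N} :=
  HB.pack f (GRing.isLinear.Build S M N *:%R f fl).

(** A total linear relation that relates 0 only to 0 is single-valued, since two images of [x]
    differ by an image of [-1 *: x + x]. Maps can thus be given by their graphs, with arbitrary
    preimages. *)
Lemma lin_of_rel M N (R : M -> N -> Prop) :
  (forall x, exists y, R x y) ->
  (forall y, R 0 y -> y = 0) ->
  (forall a x y x' y', R x y -> R x' y' -> R (a *: x + x') (a *: y + y')) ->
  exists g : {linear M -> N}, forall x, R x (g x).
Proof.
move=> ex R0 RL; have [f fR] := choice ex.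
have uniqR x y y' : R x y -> R x y' -> y = y'.
  move=> /(RL (-1)) h /h; rewrite scaleN1r addNr => /R0.
  by rewrite scaleN1r addrC => /subr0_eq.
have fl : linear f by move=> a x y; apply: uniqR (fR _) (RL _ _ _ _ _ _ _).
by exists (mklin fl).
Qed.

Definition surj M N (f : {linear M -> N}) := forall y, exists x, f x = y.

Definition ses K M N (i : {linear K -> M}) (p : {linear M -> N}) : Prop :=
  [/\ injective i, surj p & forall x, p x = 0 <-> exists y, i y = x].

Lemma lin_inj M N (f : {linear M -> N}) :
  (forall x, f x = 0 -> x = 0) -> injective f.
Proof.
by move=> h x y e; apply/subr0_eq/h; rewrite linearB /= e subrr.
Qed.

Lemma inj_eq0 M N (f : {linear M -> N}) x : injective f -> f x = 0 -> x = 0.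
Proof. by move=> fi fx; apply: fi; rewrite fx linear0. Qed.

Lemma ses_comp K M N (i : {linear K -> M}) (p : {linear M -> N}) x :
  ses i p -> p (i x) = 0.
Proof. by case=> _ _ /(_ (i x))[_]; apply; exists x. Qed.

Lemma factor_surj M N Q (p : {linear M -> N}) (f : {linear M -> Q}) :
  surj p -> (forall x, p x = 0 -> f x = 0) ->
  exists g : {linear N -> Q}, forall x, g (p x) = f x.
Proof.
move=> ps pf.
have [|y [x px <-]|a y u y' u' [x px fx] [x' px' fx']|g gE] :=
  @lin_of_rel N Q (fun y u => exists2 x, p x = y & f x = u).
- by move=> y; have [x px] := ps y; exists (f x), x.
- exact: pf.
- by exists (a *: x + x'); rewrite linearP ?px ?px' ?fx ?fx'.
exists g => x; have [x' px' <-] := gE (p x).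
by apply/subr0_eq; rewrite -linearB pf // linearB px' subrr.
Qed.

Lemma factor_inj K L M (i : {linear K -> M}) (f : {linear L -> M}) :
  injective i -> (forall x, exists y, i y = f x) ->
  exists g : {linear L -> K}, forall x, i (g x) = f x.
Proof.
move=> ii fi; apply: (@lin_of_rel L K (fun x y => i y = f x)) => //.
- by move=> y; rewrite linear0; exact: inj_eq0.
- by move=> a x y x' y' e e'; rewrite !linearP e e'.
Qed.

Definition submod_closed M (D : M -> Prop) : Prop :=
  D 0 /\ forall a x y, D x -> D y -> D (a *: x + y).

Section Submodule.
Variables (M : lmodType S) (D : M -> Prop) (Dc : submod_closed D).

(* [let _ := Dc] makes the type carry the proof its module structure needs. *)
Definition submod : Type := let _ := Dc in {x : M | `[< D x >]}.
HB.instance Definition _ := Choice.on submod.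

Let v (x : submod) : M := val x.
Let vD x : D (v x). Proof. exact/asboolP/(valP x). Qed.
Let mk x (h : D x) : submod := exist _ x (introT (asboolP _) h).
Let v_inj : injective v. Proof. exact: val_inj. Qed.

Let D_add (x y : submod) : D (v x + v y).
Proof. by rewrite -[v x]scale1r; apply: (proj2 Dc). Qed.
Let D_scale a (x : submod) : D (a *: v x).
Proof. by rewrite -[_ *: _]addr0; apply: (proj2 Dc) => //; exact: (proj1 Dc). Qed.

Let zero := mk (proj1 Dc).
Let add x y := mk (D_add x y).
Let opp x := mk (D_scale (-1) x).
Let scale a x := mk (D_scale a x).

Fact submod_addA : associative add.
Proof. by move=> x y z; apply: v_inj; exact: addrA. Qed.
Fact submod_addC : commutative add.
Proof. by move=> x y; apply: v_inj; exact: addrC. Qed.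
Fact submod_add0 : left_id zero add.
Proof. by move=> x; apply: v_inj; exact: add0r. Qed.
Fact submod_addN : left_inverse zero opp add.
Proof. by move=> x; apply: v_inj; apply: etrans (addNr (v x)); rewrite -scaleN1r. Qed.
HB.instance Definition _ := GRing.isZmodule.Build submod
  submod_addA submod_addC submod_add0 submod_addN.

Fact submod_scaleA a b x : scale a (scale b x) = scale (a * b) x.
Proof. by apply: v_inj; exact: scalerA. Qed.
Fact submod_scale1 : left_id 1 scale.
Proof. by move=> x; apply: v_inj; exact: scale1r. Qed.
Fact submod_scaleDr : right_distributive scale +%R.
Proof. by move=> a x y; apply: v_inj; exact: scalerDr. Qed.
Fact submod_scaleDl x : {morph scale^~ x : a b / a + b}.
Proof. by move=> a b; apply: v_inj; exact: scalerDl. Qed.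
HB.instance Definition _ := GRing.Zmodule_isLmodule.Build S submod
  submod_scaleA submod_scale1 submod_scaleDr submod_scaleDl.

Lemma ex_submod : exists K (i : {linear K -> M}),
  injective i /\ forall x, D x <-> exists y, i y = x.
Proof.
have vl : linear v by [].
exists submod, (mklin vl); split=> [|x]; first exact: v_inj.
split=> [Dx|[y <-]]; last exact: vD.
by exists (mk Dx).
Qed.

End Submodule.

Section Quotient.
Local Open Scope quotient_scope.
Variables (M : lmodType S) (D : M -> Prop) (Dc : submod_closed D).

Let D_opp x : D x -> D (- x).
Proof.
by move=> Dx; rewrite -scaleN1r -[_ *: _]addr0; apply: Dc.2 => //; exact: Dc.1.
Qed.
Let D_add x y : D x -> D y -> D (x + y).
Proof. by rewrite -{2}[x]scale1r; apply: Dc.2. Qed.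

Definition quot_rel (x y : M) : bool := let _ := Dc in `[< D (x - y) >].

Fact quot_rel_equiv : equiv_class_of quot_rel.
Proof.
split=> [x|x y|x y z].
- by apply/asboolP; rewrite subrr; exact: Dc.1.
- by apply/asboolP/asboolP => /D_opp; rewrite opprB.
- move=> /asboolP h1 /asboolP h2; apply/asboolP.
  by have := D_add h1 h2; rewrite addrA subrK.
Qed.
Canonical quot_equiv_rel := EquivRelPack quot_rel_equiv.

Definition quotmod : Type := {eq_quot quot_rel}.
HB.instance Definition _ := Choice.on quotmod.
HB.instance Definition _ := EqQuotient.on quotmod.

Let p (x : M) : quotmod := \pi_quotmod x.
Let pE x y : p x = p y <-> D (x - y).
Proof. by split=> [/eqquotP/asboolP //|h]; apply/eqquotP; exact/asboolP. Qed.
Let rp x : p (repr x) = x. Proof. exact: reprK. Qed.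

Let add (x y : quotmod) := p (repr x + repr y).
Let opp (x : quotmod) := p (- repr x).
Let scale a (x : quotmod) := p (a *: repr x).
Let Drp x : D (repr (p x) - x). Proof. by apply/pE; rewrite rp. Qed.

Let pD x y : add (p x) (p y) = p (x + y).
Proof. by apply/pE; rewrite opprD addrACA; apply: D_add; exact: Drp. Qed.
Let pN x : opp (p x) = p (- x).
Proof. by apply/pE; rewrite -opprD; apply: D_opp; exact: Drp. Qed.
Let pZ a x : scale a (p x) = p (a *: x).
Proof.
by apply/pE; rewrite -scalerBr -[_ *: _]addr0; apply: Dc.2 => //; exact: Dc.1.
Qed.

Fact quotmod_addA : associative add.
Proof. by move=> x y z; rewrite -(rp x) -(rp y) -(rp z) !pD addrA. Qed.
Fact quotmod_addC : commutative add.
Proof. by move=> x y; rewrite -(rp x) -(rp y) !pD addrC. Qed.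
Fact quotmod_add0 : left_id (p 0) add.
Proof. by move=> x; rewrite -(rp x) pD add0r. Qed.
Fact quotmod_addN : left_inverse (p 0) opp add.
Proof. by move=> x; rewrite -(rp x) pN pD addNr. Qed.
HB.instance Definition _ := GRing.isZmodule.Build quotmod
  quotmod_addA quotmod_addC quotmod_add0 quotmod_addN.

Fact quotmod_scaleA a b x : scale a (scale b x) = scale (a * b) x.
Proof. by rewrite -(rp x) !pZ scalerA. Qed.
Fact quotmod_scale1 : left_id 1 scale.
Proof. by move=> x; rewrite -(rp x) pZ scale1r. Qed.
Fact quotmod_scaleDr : right_distributive scale +%R.
Proof.
move=> a x y; rewrite -(rp x) -(rp y); apply: etrans (_ : scale a (add _ _) = _) _.
  by [].
by rewrite pD !pZ scalerDr -pD.
Qed.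
Fact quotmod_scaleDl x : {morph scale^~ x : a b / a + b}.
Proof. by move=> a b; rewrite -(rp x) !pZ scalerDl -pD. Qed.
HB.instance Definition _ := GRing.Zmodule_isLmodule.Build S quotmod
  quotmod_scaleA quotmod_scale1 quotmod_scaleDr quotmod_scaleDl.

Lemma ex_quotmod : exists N (q : {linear M -> N}),
  surj q /\ forall x, q x = 0 <-> D x.
Proof.
have pl : linear p by move=> a x y; rewrite -[p _]pD -[p (_ *: _)]pZ.
exists quotmod, (mklin pl); split=> [x|x].
  by exists (repr x); apply: rp.
by split=> [/(pE x 0)|Dx]; [rewrite subr0|apply/(pE x 0); rewrite subr0].
Qed.

End Quotient.

Lemma ex_ker M N (p : {linear M -> N}) : surj p ->
  exists K (i : {linear K -> M}), ses i p.
Proof.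
move=> ps; have [|K [i [ii iE]]] := @ex_submod M (fun x => p x = 0).
  by split=> [|a x y hx hy]; rewrite ?linear0 // linearP hx hy scaler0 addr0.
by exists K, i.
Qed.

Lemma ex_coker K M (i : {linear K -> M}) : injective i ->
  exists N (p : {linear M -> N}), ses i p.
Proof.
move=> ii; have [|N [p [ps pE]]] := @ex_quotmod M (fun x => exists y, i y = x).
  split=> [|a x y [u <-] [v <-]]; first by exists 0; rewrite linear0.
  by exists (a *: u + v); rewrite linearP.
by exists N, p.
Qed.

Lemma ses_split K M N (i : {linear K -> M}) (p : {linear M -> N}) :
  ses i p -> projective N -> exists s : {linear N -> M}, forall x, p (s x) = x.
Proof. by move=> [_ ps _] /(_ _ _ p idfun ps). Qed.

End Modules.

(** * Free and projective modules *)

Section FreeModules.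
Variable S : comPzRingType.
Implicit Types F K L M N P Q : lmodType S.

Lemma big_support (I : eqType) (V : zmodType) (s t : seq I) (f : I -> V) :
  uniq s -> uniq t -> {subset s <= t} -> (forall x, x \notin s -> f x = 0) ->
  \sum_(x <- s) f x = \sum_(x <- t) f x.
Proof.
move=> us ut st f0; rewrite [RHS](bigID (mem s)) /= [X in _ + X]big1 ?addr0.
  rewrite -[RHS]big_filter; apply: perm_big; apply: uniq_perm => //.
    exact: filter_uniq.
  by move=> x; rewrite mem_filter andb_idr // => /st.
exact: f0.
Qed.

(** A basis [e] is recorded with its dual coordinates [c]: finitely supported on each vector and
    jointly faithful. Coordinates that are linear maps can be tensored, which [free_tmap2_inj]
    exploits. *)
Definition free_on (I : choiceType) (F : lmodType S) (e : I -> F)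
    (c : I -> {linear F -> S^o}) : Prop :=
  [/\ forall x y, c x (e y) = (x == y)%:R,
      forall z, exists2 s, uniq s & forall x, x \notin s -> c x z = 0
    & forall z, (forall x, c x z = 0) -> z = 0].

Lemma ex_free (I : choiceType) : exists F e c, @free_on I F e c.
Proof.
pose V : lmodType S := I -> S^o.
pose D (f : V) := exists2 s, uniq s & forall x, x \notin s -> f x = 0.
have Dc : submod_closed D.
  split=> [|a f g [s us hs] [t ut ht]]; first by exists [::].
  exists (undup (s ++ t)) => [|x]; first exact: undup_uniq.
  rewrite mem_undup mem_cat negb_or => /andP[/hs fx /ht gx].
  by rewrite -[LHS]/(a *: f x + g x) fx gx scaler0 addr0.
have [F [i [ii iE]]] := ex_submod Dc.
have cl x : linear (fun z : F => i z x : S^o).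
  by move=> a y z; rewrite linearP.
have [y|e eE] := choice (_ : forall y, exists z, i z = (fun x => (x == y)%:R) :> V).
  apply/iE; exists [:: y] => // x; rewrite inE => /negbTE ->; exact: mulr0n.
exists F, e, (fun x => mklin (cl x)); split=> [x y|z|z zE].
- by rewrite -[LHS]/(i (e y) x) eE.
- by apply/iE; exists z.
- by apply: ii; rewrite linear0; apply/funext => x; rewrite -[LHS]/(mklin (cl x) z) zE.
Qed.

Section FreeOn.
Variables (I : choiceType) (F : lmodType S) (e : I -> F).
Variables (c : I -> {linear F -> S^o}) (Ff : free_on e c).

Lemma free_decomp z s : uniq s -> (forall x, x \notin s -> c x z = 0) ->
  z = \sum_(x <- s) c x z *: e x.
Proof.
case: Ff => ce _ c0 us hs; apply/subr0_eq/c0 => y; rewrite linearB linear_sum /=.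
rewrite (eq_bigr (fun x => (y == x)%:R * c x z)) => [|x _]; last first.
  by rewrite linearZ /= ce mulrC.
have [ys|/[dup] ys /hs ->] := boolP (y \in s).
  rewrite (bigD1_seq y) //= eqxx mul1r big1 ?addr0 ?subrr // => x.
  by rewrite eq_sym => /negbTE ->; rewrite mul0r.
rewrite big_seq big1 ?subr0 // => x xs; case: eqP => [yx|]; last by rewrite mul0r.
by rewrite yx xs in ys.
Qed.

Lemma free_span z : exists2 s, uniq s & z = \sum_(x <- s) c x z *: e x.
Proof. by have [_ /(_ z)[s us hs] _] := Ff; exists s => //; exact: free_decomp. Qed.

Lemma free_eq N (g h : {linear F -> N}) : (forall x, g (e x) = h (e x)) -> g =1 h.
Proof.
move=> gh z; have [s _ ->] := free_span z; rewrite !linear_sum.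
by apply: eq_bigr => x _; rewrite !linearZ /= gh.
Qed.

Lemma free_lift N (b : I -> N) : exists h : {linear F -> N}, forall x, h (e x) = b x.
Proof.
case: (Ff) => ce csupp c0.
(* Any finite set containing the support is allowed, so that two vectors can be expanded over the
   union of their sets. *)
pose R z y := exists s, [/\ uniq s, forall x, x \notin s -> c x z = 0
  & y = \sum_(x <- s) c x z *: b x].
have RL a z y z' y' : R z y -> R z' y' -> R (a *: z + z') (a *: y + y').
  move=> [s [us hs ->]] [t [ut ht ->]]; pose u := undup (s ++ t).
  have uu : uniq u := undup_uniq _.
  have su : {subset s <= u} by move=> x xs; rewrite mem_undup mem_cat xs.
  have tu : {subset t <= u} by move=> x xt; rewrite mem_undup mem_cat xt orbT.
  have E w r : uniq r -> {subset r <= u} -> (forall x, x \notin r -> c x w = 0) ->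
      \sum_(x <- r) c x w *: b x = \sum_(x <- u) c x w *: b x.
    by move=> ur ru hr; apply: big_support => // x /hr ->; rewrite scale0r.
  exists u; split=> // [x|].
    rewrite mem_undup mem_cat negb_or => /andP[/hs cx /ht cx'].
    by rewrite linearP cx cx' scaler0 addr0.
  rewrite (E _ s) // (E _ t) // scaler_sumr -big_split; apply: eq_bigr => x _ /=.
  by rewrite linearP scalerDl scalerA.
have R0 y : R 0 y -> y = 0.
  by move=> [s [_ _ ->]]; apply: big1 => x _; rewrite linear0 scale0r.
have [|h hR] := lin_of_rel _ R0 RL.
  by move=> z; have [s us hs] := csupp z; exists (\sum_(x <- s) c x z *: b x), s.
exists h => x; apply/subr0_eq/R0.
have Re : R (e x) (b x).
  exists [:: x]; split=> // [y|]; first by rewrite inE ce => /negbTE ->.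
  by rewrite big_seq1 ce eqxx scale1r.
have := RL (-1) _ _ _ _ Re (hR (e x)).
by rewrite !scaleN1r addNr addrC.
Qed.

Lemma free_projective : projective F.
Proof.
move=> M N g f gs.
have [m mE] := choice (fun x => gs (f (e x))).
have [h hE] := free_lift m; exists h.
have gh : (g \o h : {linear F -> N}) =1 f.
  by apply: free_eq => x; rewrite /= hE mE.
exact: gh.
Qed.

End FreeOn.

Lemma ex_free_cover N : exists F e c (p : {linear F -> N}), @free_on N F e c /\ surj p.
Proof.
have [F [e [c Ff]]] := ex_free N; have [p pE] := free_lift Ff id.
by exists F, e, c, p; split=> // y; exists (e y).
Qed.

Lemma ex_cover N : exists P (p : {linear P -> N}), projective P /\ surj p.
Proof.
have [F [e [c [p [Ff ps]]]]] := ex_free_cover N.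
by exists F, p; split=> //; exact: free_projective Ff.
Qed.

Lemma ex_syzygy N : exists K P (i : {linear K -> P}) (p : {linear P -> N}),
  ses i p /\ projective P.
Proof.
have [P [p [Pp ps]]] := ex_cover N; have [K [i ip]] := ex_ker ps.
by exists K, P, i, p.
Qed.

Lemma projective_retract P K (i : {linear K -> P}) (r : {linear P -> K}) :
  cancel i r -> projective P -> projective K.
Proof.
move=> ri Pp M N g f gs; have [h hE] := Pp _ _ g (f \o r) gs.
by exists (h \o i) => x; rewrite /= hE /= ri.
Qed.

Lemma projective_prod P Q : projective P -> projective Q ->
  projective ((P * Q)%type : lmodType S).
Proof.
move=> Pp Qp M N g f gs.
have i1 : linear (fun x : P => (x, 0) : (P * Q)%type).
  by move=> a x y; apply: injective_projections; rewrite //= scaler0 addr0.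
have i2 : linear (fun x : Q => (0, x) : (P * Q)%type).
  by move=> a x y; apply: injective_projections; rewrite //= scaler0 addr0.
have [h hE] := Pp _ _ g (f \o mklin i1) gs.
have [k kE] := Qp _ _ g (f \o mklin i2) gs.
have hkl : linear (fun x : (P * Q)%type => h x.1 + k x.2).
  by move=> a x y; rewrite !linearP scalerDr addrACA.
exists (mklin hkl) => -[x y] /=; rewrite linearD hE kE /= -linearD; congr (f _).
by apply: injective_projections; rewrite /= ?addr0 ?add0r.
Qed.

End FreeModules.

(** * Vanishing of Ext by syzygies, and its long exact sequence *)

Section ExtVanishing.
Variable S : comPzRingType.
Implicit Types H K L M N P Q : lmodType S.

(** The fibre product, with its universal property for jointly injective pairs only and with the
    image of the induced map. For the pairs (i, 0) and (0, i) this identifies the kernels of the two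
    projections. *)
Lemma pullback M L N (p : {linear M -> N}) (q : {linear L -> N}) :
  surj p -> surj q ->
  exists H (a : {linear H -> M}) (b : {linear H -> L}),
  [/\ surj a, surj b, forall h, p (a h) = q (b h) &
      forall K (f : {linear K -> M}) (g : {linear K -> L}),
        (forall x, p (f x) = q (g x)) ->
        (forall y, f y = 0 -> g y = 0 -> y = 0) ->
        exists u : {linear K -> H},
        [/\ injective u, forall x, a (u x) = f x, forall x, b (u x) = g x
          & forall h, (exists x, u x = h) <->
                      exists2 x, a h = f x & b h = g x]].
Proof.
move=> ps qs; pose D (h : (M * L)%type) := p h.1 = q h.2.
have Dc : submod_closed D.
  split=> [|c x y]; first by rewrite /D !linear0.
  by rewrite /D /= !linearP => -> ->.
have [H [i [ii iE]]] := ex_submod Dc.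
have al : linear (fun h => (i h).1) by move=> c x y; rewrite linearP.
have bl : linear (fun h => (i h).2) by move=> c x y; rewrite linearP.
exists H, (mklin al), (mklin bl); split.
- move=> m; have [x xE] := qs (p m).
  have [|h hE] := (iE (m, x)).1; first by rewrite /D xE.
  by exists h; rewrite /= hE.
- move=> x; have [m mE] := ps (q x).
  have [|h hE] := (iE (m, x)).1; first by rewrite /D mE.
  by exists h; rewrite /= hE.
- by move=> h; apply/iE; exists h.
move=> K f g fg fg0.
have fgl : linear (fun x => (f x, g x) : (M * L)%type).
  by move=> c x y; rewrite !linearP.
have [|u uE] := @factor_inj _ _ _ _ i (mklin fgl) ii.
  by move=> x; apply/iE; exact: fg.
have aE x : (i (u x)).1 = f x by rewrite uE.
have bE x : (i (u x)).2 = g x by rewrite uE.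
exists u; split=> // [|h].
  by apply: lin_inj => x ux; apply: fg0; rewrite -?aE -?bE ux linear0.
split=> [[x <-]|[x /= ha hb]]; first by exists x; rewrite /= ?aE ?bE.
exists x; apply: ii; rewrite uE; apply: injective_projections => /=.
  by rewrite -ha.
by rewrite -hb.
Qed.

(** The diagram behind Schanuel's lemma: the fibre product of two presentations of [N] is an
    extension of each middle term by the kernel of the other presentation. *)
Lemma pullback_ses M L N K1 K2 (i1 : {linear K1 -> M}) (p : {linear M -> N})
    (i2 : {linear K2 -> L}) (q : {linear L -> N}) :
  ses i1 p -> ses i2 q ->
  exists H (a : {linear H -> M}) (b : {linear H -> L})
    (u1 : {linear K1 -> H}) (u2 : {linear K2 -> H}),
  [/\ ses u1 b, ses u2 a, forall x, a (u1 x) = i1 x & forall x, b (u2 x) = i2 x].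
Proof.
move=> [ii1 ps pE] [ii2 qs qE].
have [H [a [b [sa sb ab uni]]]] := pullback ps qs.
have [x||u1 [u1i u1a u1b u1E]] := uni K1 i1 \0.
- by rewrite [RHS]linear0; apply/pE; exists x.
- by move=> y /(inj_eq0 ii1).
have [x||u2 [u2i u2a u2b u2E]] := uni K2 \0 i2.
- by rewrite [LHS]linear0; apply/esym/qE; exists x.
- by move=> y _ /(inj_eq0 ii2).
exists H, a, b, u1, u2; split=> //; split=> // h.
- split=> [hb|[x <-]]; last by rewrite u1b.
  apply/u1E; have /pE[x xE] : p (a h) = 0 by rewrite ab hb linear0.
  by exists x.
- split=> [ha|[x <-]]; last by rewrite u2a.
  apply/u2E; have /qE[x xE] : q (b h) = 0 by rewrite -ab ha linear0.
  by exists x.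
Qed.

(** [K2] is the preimage of [N'] in [P]. It is at once the kernel of [P -> N''] and an extension of
    [N'] by [K], which is what dimension shifting along [i] and [p] requires. *)
Lemma preimage_ses K P N N' N'' (j : {linear K -> P}) (q : {linear P -> N})
    (i : {linear N' -> N}) (p : {linear N -> N''}) :
  ses j q -> ses i p ->
  exists K2 (j2 : {linear K2 -> P}) (q2 : {linear K2 -> N'})
    (l : {linear K -> K2}),
  [/\ ses j2 (p \o q), ses l q2 & forall x, j2 (l x) = j x].
Proof.
move=> [ij qs qE] [ii ps pE].
have pqs : surj (p \o q).
  by move=> z; have [y <-] := ps z; have [x <-] := qs y; exists x.
have [K2 [j2 [ij2 _ j2E]]] := ex_ker pqs.
have [|q2 q2E] := @factor_inj _ _ _ _ i (q \o j2) ii.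
  by move=> x; apply/pE/j2E; exists x.
have [|l lE] := @factor_inj _ _ _ _ j2 j ij2.
  move=> x; apply/j2E; rewrite /= (_ : q _ = 0) ?linear0 //.
  by apply/qE; exists x.
exists K2, j2, q2, l; split=> //; split.
- by apply: lin_inj => x lx; apply: (inj_eq0 ij); rewrite -lE lx linear0.
- move=> y; have [x xE] := qs (i y).
  have /j2E[z zE] : (p \o q) x = 0 by rewrite /= xE; apply/pE; exists y.
  by exists z; apply: ii; rewrite q2E /= zE.
move=> x; split=> [x0|[y <-]].
  have /qE[y yE] : q (j2 x) = 0 by have := q2E x; rewrite x0 linear0 => /esym.
  by exists y; apply: ij2; rewrite lE.
by apply: (inj_eq0 ii); rewrite q2E /= lE; apply/qE; exists y.
Qed.

Definition extends K M Q (i : {linear K -> M}) : Prop :=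
  forall f : {linear K -> Q}, exists g : {linear M -> Q}, forall x, g (i x) = f x.

(* [ext_van Q k N] says that [Ext^(k+1)(N, Q) = 0]. *)
Fixpoint ext_van Q (k : nat) N : Prop :=
  match k with
  | 0 => forall K M (i : {linear K -> M}) (p : {linear M -> N}),
           ses i p -> extends Q i
  | k'.+1 => forall K P (i : {linear K -> P}) (p : {linear P -> N}),
           ses i p -> projective P -> ext_van Q k' K
  end.

(** Exactness of Hom(M,Q) -> Hom(K,Q) -> Ext^1(N,Q) -> Ext^1(M,Q). On the pullback of an extension
    of [N] to [M], the map [f] extends; subtracting an extension to [M] of its restriction to [K]
    lets it descend to [M1]. *)
Lemma ext_van0_of Q K M N (i : {linear K -> M}) (p : {linear M -> N}) :
  ses i p -> extends Q i -> ext_van Q 0 M -> ext_van Q 0 N.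
Proof.
move=> ip iQ MQ K1 M1 i1 p1 ip1 f.
have [H [a [b [u1 [u2 [s1 s2 au1 bu2]]]]]] := pullback_ses ip1 ip.
have [g gE] := MQ _ _ _ _ s1 f.
have [g' g'E] := iQ (g \o u2).
have [_ sa aE] := s2.
have [|G GE] := @factor_surj _ _ _ _ a (g \- (g' \o b)) sa.
  by move=> h /aE[y <-]; rewrite /= bu2 g'E subrr.
exists G => y; rewrite -au1 GE /= gE.
by rewrite (ses_comp _ s1) linear0 subr0.
Qed.

Lemma projective_ext_van Q k P : projective P -> ext_van Q k P.
Proof.
elim: k P => [|k IHk] P Pp K M i p ip.
  move=> f; have [s sE] := ses_split ip Pp; have [ii _ pE] := ip.
  have [|r rE] := @factor_inj _ _ _ _ i (idfun \- (s \o p)) ii.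
    by move=> x; apply/pE; rewrite linearB /= sE subrr.
  exists (f \o r) => y /=; congr (f _); apply: ii.
  by rewrite rE /= (ses_comp _ ip) linear0 subr0.
move=> Mp; apply: IHk.
have [s sE] := ses_split ip Pp; have [ii _ pE] := ip.
have [|r rE] := @factor_inj _ _ _ _ i (idfun \- (s \o p)) ii.
  by move=> x; apply/pE; rewrite linearB /= sE subrr.
apply: (@projective_retract _ _ _ i r) => // y.
by apply: ii; rewrite rE /= (ses_comp _ ip) linear0 subr0.
Qed.

Section LongExact.
Variable Q : lmodType S.
Local Notation EV := (ext_van Q).

(** These are fragments of the long exact sequence, kept degree by degree because their proofs
    interlock: [ext_mid] and [ext_left] at [k] yield [ext_syzygy] and [ext_right] at [k], and
    [ext_right] at [k] yields [ext_left] at [k.+1]. *)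
Definition ext_mid k := forall N' N N'' (i : {linear N' -> N}) (p : {linear N -> N''}),
  ses i p -> EV k N' -> EV k N'' -> EV k N.
Definition ext_left k := forall N' N N'' (i : {linear N' -> N}) (p : {linear N -> N''}),
  ses i p -> EV k N -> EV k.+1 N'' -> EV k N'.
Definition ext_syzygy k := forall K P N (i : {linear K -> P}) (p : {linear P -> N}),
  ses i p -> projective P -> EV k K -> EV k.+1 N.
Definition ext_right k := forall N' N N'' (i : {linear N' -> N}) (p : {linear N -> N''}),
  ses i p -> EV k N' -> EV k.+1 N -> EV k.+1 N''.

(** Independence of the presentation. The fibre product [H] of two presentations is an extension of
    [P'] by [K], so its Ext vanishes; it is also an extension of [P] by [K'], so the vanishing
    passes to [K']. *)
Lemma ext_syzygy_of k : ext_mid k -> ext_left k -> ext_syzygy k.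
Proof.
move=> mid left K P N i p ip Pp Kk K' P' i' p' ip' P'p.
have [H [a [b [u1 [u2 [s1 s2 _ _]]]]]] := pullback_ses ip ip'.
apply: left s2 _ _; last exact: projective_ext_van.
by apply: mid s1 _ _ => //; exact: projective_ext_van.
Qed.

Lemma ext_right_of k : ext_mid k -> ext_left k -> ext_right k.
Proof.
move=> mid left N' N N'' i p ip N'k Nk.
have [K [P [j [q [jq Pp]]]]] := ex_syzygy N.
have [K2 [j2 [q2 [l [s1 s2 _]]]]] := preimage_ses jq ip.
apply: (ext_syzygy_of mid left) s1 (Pp) _.
by apply: mid s2 _ N'k; exact: Nk jq Pp.
Qed.

Lemma ext_mid_left k : ext_mid k /\ ext_left k.
Proof.
elim: k => [|k [mid left]]; split.
- move=> N' N N'' i p ip N'Q N''Q K M j q jq f.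
  (* Extend in two stages: from [K] to the preimage of [N'], then to all of [M]. *)
  have [K2 [j2 [q2 [l [s1 s2 lE]]]]] := preimage_ses jq ip.
  have [g gE] := N'Q _ _ _ _ s2 f; have [h hE] := N''Q _ _ _ _ s1 g.
  by exists h => x; rewrite -lE hE.
- move=> N' N N'' i p ip NQ N''Q.
  have [K [P [j [q [jq Pp]]]]] := ex_syzygy N.
  have [K2 [j2 [q2 [l [s1 s2 lE]]]]] := preimage_ses jq ip.
  (* [K2] is a syzygy of [N''], so Ext^2 of [N''] controls Ext^1 of [K2]; maps on [K] extend to all
     of [P], hence to [K2]. *)
  apply: ext_van0_of s2 _ (N''Q _ _ _ _ s1 Pp) => f.
  have [g gE] := NQ _ _ _ _ jq f.
  by exists (g \o j2) => x; rewrite /= lE.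
- move=> N' N N'' i p ip N'k N''k K P j q jq Pp.
  have [K2 [j2 [q2 [l [s1 s2 lE]]]]] := preimage_ses jq ip.
  exact: left s2 (N''k _ _ _ _ s1 Pp) N'k.
- move=> N' N N'' i p ip Nk N''k.
  have [K [P [j [q [jq Pp]]]]] := ex_syzygy N.
  have [K2 [j2 [q2 [l [s1 s2 lE]]]]] := preimage_ses jq ip.
  exact: (ext_right_of mid left) (s2) (Nk _ _ _ _ jq Pp) (N''k _ _ _ _ s1 Pp).
Qed.

Lemma ext_van_mid k : ext_mid k. Proof. by case: (ext_mid_left k). Qed.
Lemma ext_van_left k : ext_left k. Proof. by case: (ext_mid_left k). Qed.
Lemma ext_van_syzygy k : ext_syzygy k.
Proof. by case: (ext_mid_left k); exact: ext_syzygy_of. Qed.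
Lemma ext_van_right k : ext_right k.
Proof. by case: (ext_mid_left k); exact: ext_right_of. Qed.

End LongExact.
End ExtVanishing.

(** * Resolutions by a class of modules, one syzygy at a time *)

Section Resolutions.
Variable S : comPzRingType.
Implicit Types G K L M N P Q : lmodType S.

Lemma inv_iso M N (f : {linear M -> N}) : injective f -> surj f ->
  exists g : {linear N -> M}, cancel f g /\ cancel g f.
Proof.
move=> fi fs; have [g gE] := @factor_inj _ _ _ _ f idfun fi fs.
by exists g; split=> // x; apply: fi; rewrite gE.
Qed.

Lemma ses_isor K M N N' (i : {linear K -> M}) (p : {linear M -> N})
    (f : {linear N -> N'}) : ses i p -> injective f -> surj f -> ses i (f \o p).
Proof.
move=> [ii ps pE] fi fs; split=> // [y|x].
  by have [z <-] := fs y; have [x <-] := ps z; exists x.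
by rewrite -pE; split=> [/(inj_eq0 fi)|/= ->] //; rewrite linear0.
Qed.

Lemma ses_isol K K' M N (i : {linear K -> M}) (p : {linear M -> N})
    (f : {linear K' -> K}) : ses i p -> injective f -> surj f -> ses (i \o f) p.
Proof.
move=> [ii ps pE] fi fs; split=> // [x y /ii/fi //|x].
rewrite pE; split=> [[y <-]|[y <-]]; last by exists (f y).
by have [z <-] := fs y; exists z.
Qed.

Lemma ext_van_iso Q k N N' (f : {linear N -> N'}) :
  injective f -> surj f -> ext_van Q k N -> ext_van Q k N'.
Proof.
move=> fi fs; have [g [fg gf]] := inv_iso fi fs.
have gi := can_inj gf; have gs : surj g by move=> x; exists (f x); rewrite fg.
case: k => [|k] NQ K M i p ip; first exact: NQ _ _ _ _ (ses_isor ip gi gs).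
exact: NQ _ _ _ _ (ses_isor ip gi gs).
Qed.

Section Class.
Variable X : lmodType S -> Prop.

Lemma has_resolution0_inv N : has_resolution X N 0 ->
  exists2 G, X G & exists2 f : {linear G -> N}, injective f & surj f.
Proof.
move=> [G [d [eps [XG G0 epss epsE dE]]]]; exists (G 0); first exact: XG.
exists eps => //; apply: lin_inj => x /epsE[y <-].
by rewrite (G0 1 isT y) linear0.
Qed.

Lemma has_resolutionS_inv N n : has_resolution X N n.+1 ->
  exists K G (i : {linear K -> G}) (p : {linear G -> N}),
  [/\ ses i p, X G & has_resolution X K n].
Proof.
move=> [G [d [eps [XG G0 epss epsE dE]]]].
have [K [i ip]] := ex_ker epss; have [ii _ iE] := ip.
have [|e eE] := @factor_inj _ _ _ _ i (d 0) ii.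
  by move=> x; apply/iE/epsE; exists x.
exists K, (G 0), i, eps; split=> //; first exact: XG.
exists (fun j => G j.+1), (fun j => d j.+1), e; split=> // [j jn|j jn|z|x].
- exact: XG.
- exact: G0.
- have /epsE[y yE] : eps (i z) = 0 by apply/iE; exists z.
  by exists y; apply: ii; rewrite eE.
rewrite -dE -eE; split=> [->|]; first exact: linear0.
exact: inj_eq0.
Qed.

Lemma has_resolution0 N : X N -> has_resolution X N 0.
Proof.
(* The kernel of the identity serves as the zero module in positive degrees. *)
move=> XN; have [|Z [i [ii _ iE]]] := @ex_ker _ N N idfun; first by move=> x; exists x.
have Z0 (z : Z) : z = 0 by apply: (inj_eq0 ii); apply/iE; exists z.
pose G (j : nat) := if j is 0 then N else Z.
pose d j : {linear G j.+1 -> G j} := \0.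
exists G, d, idfun; split=> [[]|[|j] _|z|x|j x] //.
- by exists z.
- by split=> [/= ->|[y <-]]; [exists 0|].
- by split=> [_|_] //; exists 0; rewrite (Z0 x).
Qed.

Lemma has_resolutionS K G N n (i : {linear K -> G}) (p : {linear G -> N}) :
  ses i p -> X G -> has_resolution X K n -> has_resolution X N n.+1.
Proof.
move=> [ii ps pE] XG [H [d [e [XH H0 es eE dE]]]].
pose G' (j : nat) := if j is j'.+1 then H j' else G.
pose d' j : {linear G' j.+1 -> G' j} :=
  match j with 0 => i \o e | j'.+1 => d j' end.
exists G', d', p; split=> // [[|j]|[|j] jn|x|[|j] x] //.
- exact: XH.
- exact: H0.
- rewrite pE; split=> [[y <-]|[y <-]]; last by exists (e y).
  by have [z <-] := es y; exists z.
- by rewrite -eE; split=> [/(inj_eq0 ii)|/= ->] //; rewrite linear0.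
- exact: dE.
Qed.

End Class.
End Resolutions.

(** * Gorenstein projective modules and vanishing of Ext *)

Section Gorenstein.
Variable S : comPzRingType.
Implicit Types G H K L M N P Q : lmodType S.

Definition ext_acyclic N := forall Q k, projective Q -> ext_van Q k N.

Definition cosyzygy N N' := exists P (i : {linear N -> P}) (p : {linear P -> N'}),
  ses i p /\ projective P.

(* The coinductive description of the Gorenstein projective modules, see
   [gproj_cogproj] and [cogproj_gproj]. *)
Definition cogproj N := exists2 C : lmodType S -> Prop, C N &
  forall G, C G -> ext_acyclic G /\ exists2 G', cosyzygy G G' & C G'.

Lemma cogproj_acyclic N : cogproj N -> ext_acyclic N.
Proof. by move=> [C CN /(_ _ CN)[]]. Qed.

Lemma cogproj_cosyzygy N : cogproj N -> exists2 N', cosyzygy N N' & cogproj N'.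
Proof. by move=> [C CN hC]; have [_ [N' NN' CN']] := hC _ CN; exists N' => //; exists C. Qed.

Lemma cogproj_step N N' : ext_acyclic N -> cosyzygy N N' -> cogproj N' -> cogproj N.
Proof.
move=> Na NN' [C CN' hC].
exists (fun G => C G \/ ext_acyclic G /\ exists2 G', cosyzygy G G' & C G').
  by right; split=> //; exists N'.
move=> G [/hC[Ga [G' GG' CG']]|[Ga [G' GG' CG']]].
  by split=> //; exists G' => //; left.
by split=> //; exists G' => //; left.
Qed.

Lemma acyclic_syzygy K N : ext_acyclic N -> cosyzygy K N -> ext_acyclic K.
Proof. by move=> Na [P [i [p [ip Pp]]]] Q k Qp; exact: (Na Q k.+1 Qp _ _ _ _ ip Pp). Qed.

(** [K i] is the image of [d i]. Hom-exactness says that maps from [K (i + 1)] to a projective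
    extend to [P (i + 1)], so Ext^1 of [K i] vanishes; higher degrees follow because [K (i + 1)] is
    a syzygy of [K i]. *)
Lemma gproj_cogproj N : gproj N -> cogproj N.
Proof.
move=> [P [d [Pp dE Hom [phi [phii phiE]]]]].
have Dc i : submod_closed (fun z => exists x, d i x = z).
  split=> [|a x y [u <-] [v <-]]; first by exists 0; rewrite linear0.
  by exists (a *: u + v); rewrite linearP.
have Kex i := cid (ex_submod (Dc i)).
pose K i := sval (Kex i); have iex i := cid (svalP (Kex i)).
pose io i : {linear K i -> P i} := sval (iex i).
have ioi i : injective (io i) by case: (svalP (iex i)).
have ioE i z : (exists x, d i x = z) <-> exists y, io i y = z.
  by case: (svalP (iex i)).
have pex i : exists p : {linear P (i + 1) -> K i}, forall x, io i (p x) = d i x.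
  by apply: factor_inj => // x; apply/ioE; exists x.
pose p i := sval (cid (pex i)).
have pE i x : io i (p i x) = d i x by exact: (svalP (cid (pex i))).
have sesK i : ses (io (i + 1)) (p i).
  split=> // [y|x].
    have /ioE[x xE] : exists y', io i y' = io i y by exists y.
    by exists x; apply: ioi; rewrite pE.
  rewrite -ioE -dE -pE; split=> [->|]; first exact: linear0.
  exact: inj_eq0.
have Kext Q i : projective Q -> extends Q (io (i + 1)).
  move=> Qp f; have [|g gE] := (Hom Q Qp (i + 1) (f \o p (i + 1))).1.
    move=> y; rewrite /= (_ : p _ _ = 0) ?linear0 //.
    by apply: (inj_eq0 (ioi (i + 1))); rewrite pE; apply/dE; exists y.
  exists g => y; have [_ /(_ y)[x <-] _] := sesK (i + 1).
  by rewrite pE -gE.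
have Ka i : ext_acyclic (K i).
  move=> Q k Qp; elim: k i => [|k IHk] i; last first.
    exact: ext_van_syzygy (sesK i) (Pp _) (IHk _).
  apply: ext_van0_of (sesK i) (Kext _ _ Qp) _.
  exact: projective_ext_van (Pp _).
(* The class is closed under isomorphism, since [N] is only isomorphic to the image [K (-1)]. *)
exists (fun G => exists i (f : {linear G -> K i}), injective f /\ surj f).
  have [|f fE] := @factor_inj _ _ _ _ (io (-1)) phi (ioi _).
    by move=> x; apply/ioE/phiE; exists x.
  exists (-1), f; split=> [|y]; first by apply: lin_inj => x fx;
    apply: (inj_eq0 phii); rewrite -fE fx linear0.
  have /ioE/phiE[x xE] : exists y', io (-1) y' = io (-1) y by exists y.
  by exists x; apply: ioi; rewrite fE.
move=> G [i [f [fi fs]]]; split.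
  have [g [fg gf]] := inv_iso fi fs => Q k Qp.
  apply: ext_van_iso (can_inj gf) _ (Ka i Q k Qp) => x.
  by exists (f x).
(* The cosyzygy of [K i] is [K (i - 1)]; the sequences have index [i + 1] on the left, so [i] is
   rewritten as [i - 1 + 1]. *)
move: f fi fs; rewrite -(subrK 1 i) => f fi fs.
exists (K (i - 1)); last by exists (i - 1), idfun; split=> // x; exists x.
exists (P (i - 1 + 1)), (io (i - 1 + 1) \o f), (p (i - 1)); split=> //.
exact: ses_isol.
Qed.

(** Chosen cosyzygies to the right and chosen syzygies to the left of [N] are spliced into a
    complex. All its images are Ext-acyclic, and Ext^1 vanishing is exactly Hom-exactness. *)
Lemma cogproj_gproj N : cogproj N -> gproj N.
Proof.
move=> [C CN hC].
(* Putting the invariants into the types [R] and [L] turns dependent choice into plain iteration of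
   a chosen function. *)
pose R : Type := {G | C G}; pose L : Type := {G | ext_acyclic G}.
have /choice[rs rsE] : forall u : R, exists v : R, cosyzygy (sval u) (sval v).
  move=> u; have [_ [G' GG' CG']] := hC _ (svalP u).
  by exists (exist _ G' CG').
have /choice[ls lsE] : forall u : L, exists v : L, cosyzygy (sval v) (sval u).
  move=> u; have [K [P [i [p ipP]]]] := ex_syzygy (sval u).
  have KN : cosyzygy K (sval u) by exists P, i, p.
  by exists (exist _ K (acyclic_syzygy (svalP u) KN)).
pose r0 : R := exist _ N CN; pose l0 : L := exist _ N (hC _ CN).1.
(* [Negz n] is -(n+1), hence [n.+1] cosyzygies. [Z 0] is [N], and [Z (i + 1)] embeds into [P i], so
   [N] lands in [P (-1)] as [gproj] demands. *)
pose Z (i : int) : lmodType S := match i with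
  | Posz n => sval (iter n ls l0) | Negz n => sval (iter n.+1 rs r0) end.
have Za i : ext_acyclic (Z i).
  by case: i => n /=; [exact: svalP|exact: (hC _ (svalP _)).1].
have ZE i : cosyzygy (Z (i + 1)) (Z i).
  case: i => [n|[|n]].
  - by rewrite -PoszD addn1; exact: lsE.
  - exact: (rsE r0).
  - by rewrite (_ : Negz n.+1 + 1 = Negz n) ?NegzE; [exact: rsE|];
      rewrite -[n.+2]addn1 PoszD opprD subrK.
pose P i := sval (cid (ZE i)); have ioex i := cid (svalP (cid (ZE i))).
pose io i : {linear Z (i + 1) -> P i} := sval (ioex i).
have piex i := cid (svalP (ioex i)).
pose pi i : {linear P i -> Z i} := sval (piex i).
have s i : ses (io i) (pi i) by case: (svalP (piex i)).
have Pp i : projective (P i) by case: (svalP (piex i)).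
pose d i : {linear P (i + 1) -> P i} := io i \o pi (i + 1).
have ioi i : injective (io i) by case: (s i).
have dE i x : d i x = 0 <-> exists y, d (i + 1) y = x.
  have [_ _ piE] := s (i + 1); have [_ ps _] := s (i + 1 + 1).
  split=> [/(inj_eq0 (ioi i))/piE[z <-]|[y <-]].
    by have [y <-] := ps z; exists y.
  by rewrite /= (ses_comp _ (s (i + 1))) linear0.
exists P, d; split=> // [Q Qp i f|].
  split=> [fd|[g gE] y]; last by rewrite gE (dE i _).2 ?linear0 //; exists y.
  have [_ ps piE] := s (i + 1); have [_ ps' _] := s (i + 1 + 1).
  have [|f' f'E] := @factor_surj _ _ _ _ (pi (i + 1)) f ps.
    by move=> x /piE[z <-]; have [y <-] := ps' z; exact: fd.
  have [g gE] := Za i Q 0 Qp _ _ _ _ (s i) f'.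
  by exists g => x; rewrite /= gE f'E.
exists (io (-1)); split=> // z; have [_ ps _] := s (-1 + 1).
by split=> [[n <-]|[x <-]]; [have [x <-] := ps n; exists x|exists (pi (-1 + 1) x)].
Qed.

Lemma mkpair_linear K M N (f : {linear K -> M}) (g : {linear K -> N}) :
  linear (fun x => (f x, g x) : (M * N)%type).
Proof. by move=> a x y; rewrite !linearP. Qed.

Lemma cogproj_projective P : projective P -> cogproj P.
Proof.
exists (@projective S) => // G Gp; split=> [Q k _|]; first exact: projective_ext_van.
(* The split sequence 0 -> G -> G x G -> G -> 0 makes [G] its own cosyzygy. *)
exists G => //; pose GG : lmodType S := (G * G)%type.
have pl : linear (fun x : GG => x.2) by move=> a x y.
exists GG, (mklin (mkpair_linear idfun \0)), (mklin pl).
split; last exact: projective_prod.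
split=> [x y [] //|y|[x y]]; first by exists (0, y).
by split=> [/= ->|[z [_ <-]] //]; exists x.
Qed.

(** A horseshoe lemma for cosyzygies. As Ext^1(G'',P') = 0, the embedding of [G'] into [P'] extends
    to [G]; together with [G -> G'' -> P''] it embeds [G] into [P' * P''], and the cokernel is again
    an extension of the chosen cosyzygies. *)
Lemma cogproj_ext N' N N'' (i : {linear N' -> N}) (p : {linear N -> N''}) :
  ses i p -> cogproj N' -> cogproj N'' -> cogproj N.
Proof.
move=> ip cN' cN''; exists (fun G => exists G' G'' (i : {linear G' -> G})
  (p : {linear G -> G''}), [/\ ses i p, cogproj G' & cogproj G'']).
  by exists N', N'', i, p.
move=> {i p ip cN' cN''}G [G' [G'' [i [p [ip c1 c2]]]]].
have a1 := cogproj_acyclic c1; have a2 := cogproj_acyclic c2.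
split=> [Q k Qp|]; first by apply: ext_van_mid ip _ _; [exact: a1|exact: a2].
have [H' [P' [i1 [p1 [s1 P'p]]]] cH'] := cogproj_cosyzygy c1.
have [H'' [P'' [i2 [p2 [s2 P''p]]]] cH''] := cogproj_cosyzygy c2.
have [a aE] := a2 P' 0 P'p _ _ _ _ ip i1.
pose PP : lmodType S := (P' * P'')%type.
pose j : {linear G -> PP} := mklin (mkpair_linear a (i2 \o p)).
have [ii ps pE] := ip; have [ii1 ps1 pE1] := s1; have [ii2 ps2 pE2] := s2.
have ji : injective j.
  apply: lin_inj => x [] ax /(inj_eq0 ii2)/pE[y yE]; move: ax; rewrite -yE aE.
  by move=> /(inj_eq0 ii1) ->; rewrite linear0.
have [H [q jq]] := ex_coker ji; have [_ qs qE] := jq.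
exists H; first by exists PP, j, q; split=> //; exact: projective_prod.
pose in1 : {linear P' -> PP} := mklin (mkpair_linear idfun \0).
have [|al alE] := @factor_surj _ _ _ _ p1 (q \o in1) ps1.
  move=> x /pE1[y <-]; apply/qE; exists (i y).
  by apply: injective_projections; rewrite /= ?aE ?(ses_comp _ ip) ?linear0.
have sndl : linear (fun x : PP => p2 x.2) by move=> c x y; rewrite linearP.
have [|be beE] := @factor_surj _ _ _ _ q (mklin sndl) qs.
  by move=> x /qE[y <-] /=; rewrite (ses_comp _ s2).
exists H', H'', al, be; split=> //; split=> [|z|z].
- apply: lin_inj => z; have [x <-] := ps1 z; rewrite alE => /qE[h [ha]].
  move=> /(inj_eq0 ii2)/pE[y yE]; apply/pE1; exists y.
  by rewrite -aE yE ha.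
- by have [y <-] := ps2 z; exists (q (0, y)); rewrite beE.
have [[x y] <-] := qs z; rewrite beE /=; split=> [/pE2[u <-]|[w]].
  have [h <-] := ps u; exists (p1 (x - a h)); rewrite alE /=.
  apply/subr0_eq; rewrite -linearB; apply/qE; exists (- h).
  rewrite linearN; apply: injective_projections => /=.
    by rewrite addrAC subrr add0r.
  by rewrite sub0r.
have [v <-] := ps1 w; rewrite alE /= => /esym/eqP.
rewrite -subr_eq0 -linearB => /eqP/qE[h [_]] /=.
by rewrite subr0 => <-; rewrite (ses_comp _ s2).
Qed.

(* If [0 -> K -> G -> N -> 0] with [K], [G] Gorenstein projective and
   [K -> P] starts a coresolution, then [K -> P] extends to [G], so that [G]
   embeds into [P * N] with the same cokernel as [K -> P]. *)
Lemma acyclic_cogproj N n : ext_acyclic N -> has_resolution (@gproj S) N n ->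
  cogproj N.
Proof.
elim: n N => [|n IHn] N Na.
  move=> /has_resolution0_inv[G /gproj_cogproj cG [f fi fs]].
  have [g [fg gf]] := inv_iso fi fs.
  have [G' [P [i [p [ip Pp]]]] cG'] := cogproj_cosyzygy cG.
  apply: cogproj_step Na _ cG'; exists P, (i \o g), p; split=> //.
  by apply: ses_isol (can_inj gf) _ => // x; exists (f x).
move=> /has_resolutionS_inv[K [G [i [p [ip /gproj_cogproj cG resK]]]]].
have Ka : ext_acyclic K.
  move=> Q k Qp; apply: ext_van_left ip _ (Na _ _ Qp).
  exact: cogproj_acyclic.
have cK := IHn K Ka resK.
have [K' [P [i1 [p1 [s1 Pp]]]] cK'] := cogproj_cosyzygy cK.
have [g gE] := Na P 0 Pp _ _ _ _ ip i1.
have [ii ps pE] := ip; have [ii1 ps1 pE1] := s1.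
pose PN : lmodType S := (P * N)%type.
pose j : {linear G -> PN} := mklin (mkpair_linear g p).
(* The cokernel map sends (x, p u) to p1 (x - g u). Another choice of [u] changes g u by an element
   of the image of [i1], which [p1] kills. *)
have [||c z x z' x' [u [uz ->]] [u' [uz' ->]]|q qR] := @lin_of_rel _ PN K'
    (fun z x => exists u, p u = z.2 /\ x = p1 (z.1 - g u)).
- by move=> [x y]; have [u uE] := ps y; exists (p1 (x - g u)), u.
- move=> x [u [/pE[v <-] ->]].
  by rewrite sub0r linearN gE (ses_comp _ s1) oppr0.
- exists (c *: u + u'); split; first by rewrite linearP uz uz'.
  by rewrite -linearP; congr (p1 _); rewrite /= linearP scalerBr opprD addrACA.
have qE x u : q (x, p u) = p1 (x - g u).
  have [w [/= pw ->]] := qR (x, p u).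
  have /pE[t tE] : p (u - w) = 0 by rewrite linearB pw subrr.
  apply/subr0_eq; rewrite -linearB opprB addrC addrA subrK -linearB -tE gE.
  exact: ses_comp s1.
have jq : ses j q.
  split=> [|x|[x y]].
  - apply: lin_inj => x [] gx /pE[y yE]; move: gx; rewrite -yE gE.
    by move=> /(inj_eq0 ii1) ->; rewrite linear0.
  - by have [y <-] := ps1 x; exists (y, p 0); rewrite qE linear0 subr0.
  - have [u <-] := ps y; rewrite qE; split=> [/pE1[v vE]|[h [hx hy]]].
      exists (u + i v); apply: injective_projections; rewrite /= linearD.
        by rewrite gE vE addrC subrK.
      by rewrite (ses_comp _ ip) addr0.
    have /pE[v vE] : p (h - u) = 0 by rewrite linearB hy subrr.
    by apply/pE1; exists v; rewrite -gE vE linearB hx.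
have cPN : cogproj PN by exact: cogproj_ext jq cG cK'.
(* It remains to pass from [P * N] to its summand [N]. Embed [P * N] in a projective [P3] with
   cokernel [H] and divide [P3] by [N] alone: the quotient [N'] is an extension of [H] by [P], hence
   a suitable cosyzygy of [N]. *)
have [H [P3 [j3 [p3 [s3 P3p]]]] cH] := cogproj_cosyzygy cPN.
have [ii3 ps3 pE3] := s3.
pose k : {linear N -> P3} := j3 \o mklin (mkpair_linear \0 idfun).
have ki : injective k by move=> x y /ii3[].
have [N' [r kr]] := ex_coker ki; have [_ rs rE] := kr.
suff cN' : cogproj N' by apply: cogproj_step Na _ cN'; exists P3, k, r.
pose al : {linear P -> N'} := r \o (j3 \o mklin (mkpair_linear idfun \0)).
have [|be beE] := @factor_surj _ _ _ _ r p3 rs.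
  by move=> x /rE[y <-]; exact: ses_comp s3.
apply: (@cogproj_ext P N' H al be) (cogproj_projective Pp) cH.
split=> [|z|z].
- by apply: lin_inj => x /rE[y /ii3[]].
- by have [x <-] := ps3 z; exists (r x); rewrite beE.
have [x <-] := rs z; rewrite beE; split=> [/pE3[[y t] <-]|[y yE]].
  exists y; apply/subr0_eq; rewrite /= -linearB; apply/rE.
  exists (- t); rewrite -linearB; congr (j3 _); apply: injective_projections => /=.
    by rewrite subrr.
  by rewrite sub0r.
by rewrite -beE -yE beE; exact: ses_comp s3.
Qed.

(** Dimension shifting down the resolution. As [ext_van Q k] concerns degree k+1, the bound [n <= k]
    covers exactly the degrees above n. *)
Lemma gpd_ext_van N n k Q : has_resolution (@gproj S) N n -> projective Q ->
  (n <= k)%N -> ext_van Q k N.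
Proof.
move=> + Qp; elim: n N k => [|n IHn] N k.
  move=> /has_resolution0_inv[G /gproj_cogproj/cogproj_acyclic Ga [f fi fs]] _.
  exact: ext_van_iso fi fs (Ga Q k Qp).
move=> /has_resolutionS_inv[K [G [i [p [ip /gproj_cogproj/cogproj_acyclic Ga resK]]]]].
by case: k => // k nk; apply: ext_van_right ip (IHn _ _ resK nk) (Ga _ _ Qp).
Qed.

End Gorenstein.

(** * Exactness of the tensor product and vanishing of Tor *)

Section TensorExactness.
Variable A : comPzRingType.
Implicit Types E F K L M N P Q : lmodType A.

Lemma tens_ext M N P (g h : {linear tens M N -> P}) :
  (forall x y, g (pure x y) = h (pure x y)) -> g =1 h.
Proof.
move=> gh t; rewrite (tens_sum_pure t) !linear_sum.
by apply: eq_bigr => -[x y] _; exact: gh.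
Qed.

(* Locked so that simplification does not unfold it to [tens_val]. *)
Definition tens_lift M N P (b : M -> N -> P) (bb : bilin b) : {linear tens M N -> P} :=
  locked (mklin (tens_val_linear bb)).

Lemma tens_liftE M N P (b : M -> N -> P) (bb : bilin b) :
  tens_lift bb =1 tens_val b.
Proof. by move=> t; rewrite /tens_lift -lock. Qed.

Lemma tens_lift_pure M N P (b : M -> N -> P) (bb : bilin b) x y :
  tens_lift bb (pure x y) = b x y.
Proof. by rewrite tens_liftE tens_val_pure. Qed.

Definition tmap1 M M' N (f : {linear M -> M'}) : {linear tens M N -> tens M' N} :=
  tens_lift (tens_map_bilin N f).
Arguments tmap1 {M M'} N f.

Lemma tmap1_pure M M' N (f : {linear M -> M'}) x (y : N) :
  tmap1 N f (pure x y) = pure (f x) y.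
Proof. exact: tens_lift_pure. Qed.

Lemma bilin_comp2 M N N' P (b : M -> N' -> P) (f : {linear N -> N'}) :
  bilin b -> bilin (fun x y => b x (f y)).
Proof.
move=> bb; split=> [x|y] a u v; last exact: bb.2.
by rewrite linearP; exact: bb.1.
Qed.

Lemma bilin_swap M N P (b : M -> N -> P) : bilin b -> bilin (fun y x => b x y).
Proof. by case=> b1 b2; split. Qed.

Definition tmap2 M N N' (f : {linear N -> N'}) : {linear tens M N -> tens M N'} :=
  tens_lift (bilin_comp2 f (pure_bilin M N')).
Arguments tmap2 M {N N'} f.

Lemma tmap2_pure M N N' (f : {linear N -> N'}) (x : M) y :
  tmap2 M f (pure x y) = pure x (f y).
Proof. exact: tens_lift_pure. Qed.

Lemma tmap12 M M' N N' (f : {linear M -> M'}) (g : {linear N -> N'}) t :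
  tmap1 N' f (tmap2 M g t) = tmap2 M' g (tmap1 N f t).
Proof.
apply: (@tens_ext _ _ _ (tmap1 N' f \o tmap2 M g) (tmap2 M' g \o tmap1 N f)) t => x y.
by rewrite /= tmap2_pure !tmap1_pure tmap2_pure.
Qed.

Lemma tmap1K M M' N (f : {linear M -> M'}) (g : {linear M' -> M}) :
  cancel f g -> cancel (tmap1 N f) (tmap1 N g).
Proof.
move=> fg; apply: (@tens_ext _ _ _ (tmap1 N g \o tmap1 N f) idfun) => x y.
by rewrite /= !tmap1_pure fg.
Qed.

Lemma tmap2K M N N' (f : {linear N -> N'}) (g : {linear N' -> N}) :
  cancel f g -> cancel (tmap2 M f) (tmap2 M g).
Proof.
move=> fg; apply: (@tens_ext _ _ _ (tmap2 M g \o tmap2 M f) idfun) => x y.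
by rewrite /= !tmap2_pure fg.
Qed.

Lemma pure0l M N (y : N) : pure (0 : M) y = 0.
Proof.
have := linear0 (mklin ((pure_bilin M N).2 y)); exact.
Qed.

Lemma pure0r M N (x : M) : pure x (0 : N) = 0.
Proof.
have := linear0 (mklin ((pure_bilin M N).1 x)); exact.
Qed.

Lemma pureDr M N (x : M) : {morph @pure A M N x : u v / u + v}.
Proof. exact: (linearD (mklin ((pure_bilin M N).1 x))). Qed.

Lemma pureDl M N (x x' : M) (y : N) : pure (x + x') y = pure x y + pure x' y.
Proof. exact: (linearD (mklin ((pure_bilin M N).2 y))). Qed.

Lemma pure_suml M N (I : Type) (r : seq I) (f : I -> M) (y : N) :
  pure (\sum_(i <- r) f i) y = \sum_(i <- r) pure (f i) y.
Proof. exact: (linear_sum (mklin ((pure_bilin M N).2 y))). Qed.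

Lemma pureZl M N a (x : M) (y : N) : pure (a *: x) y = a *: pure x y.
Proof. exact: (scalable_linear ((pure_bilin M N).2 y)). Qed.

Lemma pureZr M N a (x : M) (y : N) : pure x (a *: y) = a *: pure x y.
Proof. exact: (scalable_linear ((pure_bilin M N).1 x)). Qed.

Lemma tmap1_surj M N E (p : {linear M -> N}) : surj p -> surj (tmap1 E p).
Proof.
move=> ps t; rewrite (tens_sum_pure t).
elim: (repr t) => [|[y e] s [u uE]]; first by exists 0; rewrite big_nil linear0.
have [x xE] := ps y; exists (pure x e + u).
by rewrite big_cons linearD uE tmap1_pure xE.
Qed.

(* The cokernel of [K (x) E -> M (x) E] receives a map from [N (x) E]. *)
Lemma tmap1_exact K M N E (i : {linear K -> M}) (p : {linear M -> N}) :
  surj p -> (forall x, p x = 0 <-> exists y, i y = x) ->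
  forall t, tmap1 E p t = 0 <-> exists u, tmap1 E i u = t.
Proof.
move=> ps pE t; split=> [|[u <-]]; last first.
  apply: (@tens_ext _ _ _ (tmap1 E p \o tmap1 E i) \0) u => x y.
  by rewrite /= !tmap1_pure (_ : p _ = 0) ?pure0l //; apply/pE; exists x.
have [|C [q [qs qE]]] := @ex_quotmod _ (tens M E) (fun t => exists u, tmap1 E i u = t).
  split=> [|a x y [u <-] [v <-]]; first by exists 0; rewrite linear0.
  by exists (a *: u + v); rewrite linearP.
(* [s] is only a set-theoretic section; modulo the image of [K], the class of a pure tensor depends
   on [p x] alone, and this restores bilinearity. *)
have [s sE] := choice ps.
have q_p x x' e : p x = p x' -> q (pure x e) = q (pure x' e).
  move=> /eqP; rewrite -subr_eq0 -linearB => /eqP/pE[y yE].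
  apply/subr0_eq; rewrite -linearB; apply/qE; exists (pure y e).
  by rewrite tmap1_pure yE; exact: linearB (mklin ((pure_bilin M E).2 e)) _ _.
have bb : bilin (fun y e => q (pure (s y) e)).
  split=> [y|e] a u v; first by rewrite ((pure_bilin _ _).1 _) linearP.
  rewrite -linearP -(proj2 (pure_bilin _ _)); apply: q_p.
  by rewrite linearP !sE.
have lE : tens_lift bb \o tmap1 E p =1 q.
  by apply: tens_ext => x e; rewrite /= tmap1_pure tens_lift_pure; exact/q_p/sE.
by move=> t0; apply/qE; rewrite -lE /= t0 linear0.
Qed.

Definition tswap M N : {linear tens M N -> tens N M} :=
  tens_lift (bilin_swap (pure_bilin N M)).
Arguments tswap M N : clear implicits.

Lemma tswap_pure M N (x : M) (y : N) : tswap M N (pure x y) = pure y x.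
Proof. exact: tens_lift_pure. Qed.

Lemma tswapK M N : cancel (tswap M N) (tswap N M).
Proof.
apply: (@tens_ext _ _ _ (tswap N M \o tswap M N) idfun) => x y.
by rewrite /= !tswap_pure.
Qed.

Lemma tmap2_swap M N N' (f : {linear N -> N'}) t :
  tswap M N' (tmap2 M f t) = tmap1 M f (tswap M N t).
Proof.
apply: (@tens_ext _ _ _ (tswap M N' \o tmap2 M f) (tmap1 M f \o tswap M N)) => x y.
by rewrite /= tmap2_pure !tswap_pure tmap1_pure.
Qed.

Lemma tmap2_surj M E F (p : {linear E -> F}) : surj p -> surj (tmap2 M p).
Proof.
move=> ps t; have [u uE] := tmap1_surj ps (tswap M F t).
exists (tswap E M u); apply: (can_inj (@tswapK M F)).
by rewrite tmap2_swap tswapK.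
Qed.

Lemma tmap2_exact M E' F E (i : {linear E' -> F}) (p : {linear F -> E}) :
  surj p -> (forall x, p x = 0 <-> exists y, i y = x) ->
  forall t, tmap2 M p t = 0 <-> exists u, tmap2 M i u = t.
Proof.
move=> ps pE t; have ex := tmap1_exact ps pE (tswap M F t).
rewrite -tmap2_swap in ex; split=> [t0|[u <-]].
  have [u uE] := ex.1 (etrans (congr1 _ t0) (linear0 _)).
  exists (tswap E' M u); apply: (can_inj (@tswapK M F)).
  by rewrite tmap2_swap tswapK.
apply: (can_inj (@tswapK M E)); rewrite linear0 tmap2_swap.
apply/(tmap1_exact ps pE); exists (tswap M E' u).
by rewrite tmap2_swap.
Qed.

(** Each coordinate of [P] induces a map [th] from the tensor product to [N], natural in [N], and
    [t] is the sum of the tensors of [e x] with [th E x t]. If [t] dies under [g], then so do all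
    [th E x t], which therefore vanish. *)
Lemma free_tmap2_inj (I : choiceType) (P : lmodType A) (e : I -> P) c E F
    (g : {linear E -> F}) : free_on e c -> injective g -> injective (tmap2 P g).
Proof.
move=> Pf gi.
have cb N x : bilin (fun (z : P) (y : N) => (c x z : A) *: y).
  split=> [z|y] a u v; first by rewrite scalerDr !scalerA mulrC.
  by rewrite linearP scalerDl scalerA.
pose th N x : {linear tens P N -> N} := tens_lift (cb N x).
have thg x t : th F x (tmap2 P g t) = g (th E x t).
  apply: (@tens_ext _ _ _ (th F x \o tmap2 P g) (g \o th E x)) t => z y.
  by rewrite /= tmap2_pure !tens_lift_pure linearZ.
(* The expansion is claimed for every larger index set, so that the induction can add two tensors
   over a common one. *)
have dec (t : tens P E) : exists s : seq I, forall s', uniq s' -> {subset s <= s'} ->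
    t = \sum_(x <- s') pure (e x) (th E x t).
  rewrite [X in exists s, forall s' _ _, X = _](tens_sum_pure t).
  rewrite {2}(tens_sum_pure t).
  elim: (repr t) => [|[z y] r [s sE]].
    by exists [::] => s' _ _; rewrite big_nil big1 // => x _; rewrite linear0 pure0r.
  have [_ /(_ z)[w uw wz] _] := Pf.
  exists (w ++ s) => s' us' ss'; rewrite big_cons.
  rewrite [in LHS](sE s') // => [|x xs]; last by apply: ss'; rewrite mem_cat xs orbT.
  have pE : pure z y = \sum_(x <- s') pure (e x) (th E x (pure z y)).
    rewrite {1}(free_decomp Pf us' (z := z)) => [|x xs']; last first.
      by apply: wz; apply: contra xs' => xw; apply: ss'; rewrite mem_cat xw.
    rewrite pure_suml; apply: eq_bigr => x _.
    by rewrite tens_lift_pure pureZl pureZr.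
  rewrite [in LHS]pE -big_split; apply: eq_bigr => x _ /=.
  by rewrite linearD pureDr.
apply: lin_inj => t t0; have [s sE] := dec t.
rewrite (sE (undup s)) ?undup_uniq // => [|x]; last by rewrite mem_undup.
apply: big1 => x _; rewrite (_ : th _ _ _ = 0) ?pure0r //.
by apply: (inj_eq0 gi); rewrite -thg t0 linear0.
Qed.

Lemma projective_tmap2_inj P E F (g : {linear E -> F}) :
  projective P -> injective g -> injective (tmap2 P g).
Proof.
move=> Pp gi; have [Fr [e [c [p [Ff ps]]]]] := ex_free_cover P.
have [s sE] := Pp _ _ p idfun ps.
apply: lin_inj => t t0; apply: (inj_eq0 (can_inj (tmap1K sE))).
by apply: (inj_eq0 (free_tmap2_inj Ff gi)); rewrite -tmap12 t0 linear0.
Qed.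

Lemma flat_tmap1 E M N (f : {linear M -> N}) : flat E -> injective f ->
  injective (tmap1 E f).
Proof. by move=> Ef fi t u; rewrite /tmap1 !tens_liftE; exact: Ef. Qed.

(* [tor_van E k M] says that [Tor_(k+1)(M, E) = 0]. *)
Fixpoint tor_van E (k : nat) M : Prop :=
  match k with
  | 0 => forall K P (i : {linear K -> P}) (p : {linear P -> M}),
           ses i p -> projective P -> injective (tmap1 E i)
  | k'.+1 => forall K P (i : {linear K -> P}) (p : {linear P -> M}),
           ses i p -> projective P -> tor_van E k' K
  end.

Lemma flat_tor_van E k M : flat E -> tor_van E k M.
Proof.
move=> Ef; elim: k M => [|k IHk] M K P i p [ii _ _] Pp; last exact: IHk.
exact: flat_tmap1.
Qed.

Lemma flat_iso E E' (f : {linear E -> E'}) : injective f -> surj f ->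
  flat E -> flat E'.
Proof.
move=> fi fs Ef M M' h hi; have [g [fg gf]] := inv_iso fi fs.
have h' : injective (tmap1 E' h).
  apply: lin_inj => t t0; apply: (inj_eq0 (can_inj (tmap2K gf))).
  by apply: (inj_eq0 (flat_tmap1 Ef hi)); rewrite tmap12 t0 linear0.
by move=> t u; have := h' t u; rewrite /tmap1 !tens_liftE.
Qed.

(** Only [k = 0] needs an argument, as higher degrees unfold to syzygies. It is a chase in the
    tensor product of K2 -> P1 -> K1 -> P0 with E' -> F -> E. *)
Lemma tor_van_shift E' F E (g : {linear E' -> F}) (h : {linear F -> E}) k M :
  ses g h -> flat F -> tor_van E' k M -> tor_van E k.+1 M.
Proof.
move=> [gi hs hE] Ff; elim: k M => [|k IHk] M MT K1 P0 i1 p0 s1 P0p; last first.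
  by apply: IHk; exact: MT s1 P0p.
move=> K2 P1 i2 p1 [i2i p1s p1E] P1p; apply: lin_inj => t t0.
have [s st] := tmap2_surj hs t.
have /(tmap2_exact hs hE)[u uE] : tmap2 P1 h (tmap1 F i2 s) = 0.
  by rewrite -tmap12 st.
(* K1 (x) E' embeds into P0 (x) E' because Tor_1(M,E') = 0, and from there into P0 (x) F because
   [P0] is projective. In P0 (x) F the element becomes the image of [s] through K2 -> P1 -> K1,
   which is 0. *)
have /(tmap1_exact p1s p1E)[w wE] : tmap1 E' p1 u = 0.
  apply: (inj_eq0 (MT _ _ _ _ s1 P0p)).
  apply: (inj_eq0 (projective_tmap2_inj P0p gi)).
  rewrite -!tmap12 uE (_ : tmap1 F p1 _ = 0) ?linear0 //.
  by apply/(tmap1_exact p1s p1E); exists s.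
have gw : tmap2 K2 g w = s.
  by apply: (flat_tmap1 Ff i2i); rewrite tmap12 wE uE.
by rewrite -st; apply/(tmap2_exact hs hE); exists w.
Qed.

Lemma fd_tor_van E r k M : has_resolution (@flat A) E r -> (r <= k)%N -> tor_van E k M.
Proof.
elim: r E k => [|r IHr] E k.
  move=> /has_resolution0_inv[G Gf [f fi fs]] _.
  exact/flat_tor_van/(flat_iso fi fs Gf).
move=> /has_resolutionS_inv[K [G [i [p [ip Gf Kr]]]]].
by case: k => // k rk; apply: tor_van_shift ip Gf (IHr _ _ Kr rk).
Qed.

End TensorExactness.
Arguments tmap1 {A M M'} N f.

(** * Change of rings between A and its trivial extension *)

Section TrivialExtensionModules.
Variables (A : comPzRingType) (E : lmodType A).
Local Notation R := (trivext E).
Implicit Types K M N P Q : lmodType A.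

(* [M (x)_A R] is [M * (M (x) E)] with [(a, e) (m, t) = (a m, a t + m (x) e)]. *)
Section ExtendScalars.
Variable M : lmodType A.

Definition extmod : Type := (M * tens M E)%type.
HB.instance Definition _ := GRing.Zmodule.copy extmod (M * tens M E)%type.

Definition extmod_scale (c : R) (x : extmod) : extmod :=
  (c.1 *: x.1, c.1 *: x.2 + pure x.1 c.2).

Fact extmod_scaleA a b x : extmod_scale a (extmod_scale b x) = extmod_scale (a * b) x.
Proof.
apply: injective_projections => /=; first by rewrite scalerA.
by rewrite scalerDr scalerA pureDr !pureZr pureZl addrA.
Qed.
Fact extmod_scale1 : left_id 1 extmod_scale.
Proof.
by move=> x; apply: injective_projections; rewrite /= scale1r ?pure0r ?addr0.
Qed.
Fact extmod_scaleDr : right_distributive extmod_scale +%R.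
Proof.
move=> a x y; apply: injective_projections => /=; first by rewrite scalerDr.
by rewrite scalerDr pureDl addrACA.
Qed.
Fact extmod_scaleDl x : {morph extmod_scale^~ x : a b / a + b}.
Proof.
move=> a b; apply: injective_projections => /=; first by rewrite scalerDl.
by rewrite scalerDl pureDr addrACA.
Qed.
HB.instance Definition _ := GRing.Zmodule_isLmodule.Build R extmod
  extmod_scaleA extmod_scale1 extmod_scaleDr extmod_scaleDl.

End ExtendScalars.

Section RestrictScalars.
Variable L : lmodType R.

Definition resmod : Type := L.
HB.instance Definition _ := GRing.Zmodule.copy resmod L.

Definition resmod_scale (a : A) (x : resmod) : resmod := ((a, 0) : R) *: (x : L).

Fact resmod_scaleA a b x : resmod_scale a (resmod_scale b x) = resmod_scale (a * b) x.
Proof.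
rewrite /resmod_scale scalerA; congr (_ *: _); apply: injective_projections => //=.
by rewrite !scaler0 addr0.
Qed.
Fact resmod_scale1 : left_id 1 resmod_scale.
Proof. exact: scale1r. Qed.
Fact resmod_scaleDr : right_distributive resmod_scale +%R.
Proof. by move=> a x y; exact: scalerDr. Qed.
Fact resmod_scaleDl x : {morph resmod_scale^~ x : a b / a + b}.
Proof.
move=> a b; rewrite /resmod_scale -[RHS]scalerDl; congr (_ *: _).
by apply: injective_projections; rewrite /= ?addr0.
Qed.
HB.instance Definition _ := GRing.Zmodule_isLmodule.Build A resmod
  resmod_scaleA resmod_scale1 resmod_scaleDr resmod_scaleDl.

End RestrictScalars.

Lemma extmap_linear M N (f : {linear M -> N}) :
  linear (fun x : extmod M => (f x.1, tmap1 E f x.2) : extmod N).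
Proof.
move=> c x y; apply: injective_projections; first by rewrite /= linearP.
by rewrite /= -tmap1_pure !linearD linearZ.
Qed.

Definition extmap M N (f : {linear M -> N}) : {linear extmod M -> extmod N} :=
  mklin (extmap_linear f).

Lemma extmap_ses K M N (i : {linear K -> M}) (p : {linear M -> N}) :
  ses i p -> injective (tmap1 E i) -> ses (extmap i) (extmap p).
Proof.
move=> [ii ps pE] Ei; have Eex := tmap1_exact (E := E) ps pE.
split=> [[x t] [y u] [/ii -> /Ei ->] //|[y u]|[x t]].
  have [x <-] := ps y; have [t <-] := tmap1_surj ps u.
  by exists (x, t).
split=> [[/pE[y <-] /Eex[u <-]]|[[y u] [<- <-]]]; first by exists (y, u).
congr pair; first by apply/pE; exists y.
by apply/Eex; exists u.
Qed.

(** By adjunction, R-maps out of [extmod P] are A-maps out of [P]. Lift f on P x 0 to an A-map [h0];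
    the R-linear lift is then forced to send p (x) e to (0, e) acting on [h0 p], which defines
    [B]. *)
Lemma extmod_projective P : projective P -> projective (extmod P : lmodType R).
Proof.
move=> Pp M N g f gs.
have f0l : linear (fun p : P => f ((p, 0) : extmod P) : resmod N).
  move=> a x y; rewrite -[RHS]linearP; congr (f _).
  by apply: injective_projections; rewrite /= ?pure0r ?scaler0 ?addr0.
have gl : linear (g : resmod M -> resmod N) by move=> a x y; exact: linearP.
have [h0 h0E] := Pp _ _ (mklin gl) (mklin f0l) gs.
pose act (e : E) (x : M) : M := ((0, e) : R) *: x.
have actDl a u v x : act (a *: u + v) x = ((a, 0) : R) *: act u x + act v x.
  rewrite /act scalerA -scalerDl; congr (_ *: _).
  by apply: injective_projections; rewrite /= ?mulr0 ?addr0 // scale0r addr0.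
have actDr a e x y : act e (((a, 0) : R) *: x + y) = ((a, 0) : R) *: act e x + act e y.
  by rewrite /act scalerDr !scalerA mulrC.
have bb : bilin (fun p e => act e (h0 p) : resmod M).
  by split=> [p|e] a u v; [exact: actDl|rewrite linearP; exact: actDr].
pose B := tens_lift bb.
(* The ideal 0 x E has square zero in R. *)
have actB0 e t : act e (B t) = 0.
  rewrite (tens_sum_pure t) linear_sum /act scaler_sumr big1 // => -[p u] _.
  rewrite tens_lift_pure /act scalerA (_ : _ * _ = 0) ?scale0r //.
  by apply: injective_projections; rewrite /= ?mulr0 // !scale0r addr0.
have split_scale (c : R) (x : M) : c *: x = ((c.1, 0) : R) *: x + act c.2 x.
  rewrite /act -scalerDl; congr (_ *: _).
  by apply: injective_projections; rewrite /= ?addr0 ?add0r.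
pose h (x : extmod P) : M := (h0 x.1 : M) + (B x.2 : M).
have hl : linear h.
  move=> c x y; rewrite /h.
  have -> : h0 (c *: x + y).1 = ((c.1, 0) : R) *: (h0 x.1 : M) + h0 y.1 :> M.
    exact: linearP.
  have -> : B (c *: x + y).2
      = ((c.1, 0) : R) *: (B x.2 : M) + act c.2 (h0 x.1) + B y.2 :> M.
    by rewrite /= !linearD linearZ tens_lift_pure.
  rewrite scalerDr [c *: (h0 _ : M)]split_scale [c *: (B _ : M)]split_scale actB0 addr0.
  rewrite addrACA; congr (_ + _); rewrite addrA addrAC -addrA.
  by rewrite [X in _ + X]addrC addrA.
exists (mklin hl) => -[p t]; rewrite /= /h linearD /=.
have -> : g (h0 p) = f ((p, 0) : extmod P) by exact: h0E.
have -> : g (B t) = f ((0, t) : extmod P).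
  have zl : linear (fun t => f ((0, t) : extmod P) : resmod N).
    move=> a u v; rewrite -[RHS]linearP; congr (f _).
    by apply: injective_projections; rewrite /= ?pure0l ?scaler0 ?addr0.
  apply: (@tens_ext _ _ _ _ (mklin gl \o B) (mklin zl)) t => q e.
  rewrite /= tens_lift_pure linearZ.
  have -> : g (h0 q) = f ((q, 0) : extmod P) by exact: h0E.
  rewrite -linearZ; congr (f _).
  by apply: injective_projections; rewrite /= scale0r ?add0r.
by rewrite -linearD; congr (f _); apply: injective_projections; rewrite /= ?addr0 ?add0r.
Qed.

(** Vanishing Tor keeps presentations exact under [extmap], so syzygies correspond over the two
    rings. In the lowest degree, [extmap f] extends over R, and the [Q]-component of that extension
    on P x 0 extends [f]. *)
Lemma extmod_ext_van Q k M : (forall j, tor_van E j M) ->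
  ext_van (extmod Q : lmodType R) k (extmod M) -> ext_van Q k M.
Proof.
elim: k M => [|k IHk] M MT MQ; last first.
  move=> K P i p ip Pp; apply: IHk => [j|].
    exact: (MT j.+1 _ _ _ _ ip Pp).
  have s := extmap_ses ip (MT 0 _ _ _ _ ip Pp).
  exact: (MQ _ _ _ _ s (extmod_projective Pp)).
have [K [P [i [p [ip Pp]]]]] := ex_syzygy M.
apply: ext_van0_of (ip) _ (projective_ext_van _ _ Pp) => f.
have [g gE] := MQ _ _ _ _ (extmap_ses ip (MT 0 _ _ _ _ ip Pp)) (extmap f).
have gl : linear (fun x : P => (g ((x, 0) : extmod P)).1).
  move=> a x y; rewrite (_ : (_, _) = ((a, 0) : R) *: ((x, 0) : extmod P) + (y, 0)).
    by rewrite linearP.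
  by apply: injective_projections; rewrite /= ?pure0r ?scaler0 ?addr0.
exists (mklin gl) => x /=.
have -> : ((i x, 0) : extmod P) = extmap i ((x, 0) : extmod K).
  by rewrite /= linear0.
by rewrite gE.
Qed.

End TrivialExtensionModules.

(** * Gorenstein dimension bounds, and infima and suprema of dimensions *)

Section GorensteinDimension.

(** After [n] syzygies the hypothesis reads [ext_van Q k] for all [k]; by [fin] the syzygy also has
    finite Gorenstein projective dimension, so [acyclic_cogproj] applies. *)
Lemma gpd_le_of_ext_van (S : comPzRingType) (N : lmodType S) n :
  (forall M : lmodType S, exists m, has_resolution (@gproj S) M m) ->
  (forall Q k, projective Q -> ext_van Q (n + k) N) ->
  has_resolution (@gproj S) N n.
Proof.
move=> fin; elim: n N => [|n IHn] N Nn.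
  have [m Nm] := fin N; apply/has_resolution0/cogproj_gproj.
  by apply: acyclic_cogproj Nm => Q k Qp; exact: Nn.
have [K [P [i [p [ip Pp]]]]] := ex_syzygy N.
apply: has_resolutionS (ip) _ _; first exact/cogproj_gproj/cogproj_projective.
by apply: IHn => Q k Qp; exact: (Nn Q k Qp _ _ _ _ ip Pp).
Qed.

Lemma gpd_trivext (A : comPzRingType) (E M : lmodType A) n r :
  (forall N : lmodType A, exists m, has_resolution (@gproj A) N m) ->
  (forall L : lmodType (trivext E),
     exists2 m, (m <= n)%N & has_resolution (@gproj (trivext E)) L m) ->
  (forall k, tor_van E (r + k) M) ->
  has_resolution (@gproj A) M (r + n).
Proof.
move=> finA finR; elim: r M => [|r IHr] M MT; last first.
  have [K [P [i [p [ip Pp]]]]] := ex_syzygy M.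
  apply: has_resolutionS (ip) _ _; first exact/cogproj_gproj/cogproj_projective.
  by apply: IHr => k; exact: (MT k _ _ _ _ ip Pp).
apply: gpd_le_of_ext_van => // Q k Qp; apply: (@extmod_ext_van _ E) => //.
(* Over R, degree n+k+1 lies above the Gorenstein projective dimension of [extmod E M]. *)
have [m mn Lm] := finR (extmod E M).
apply: gpd_ext_van Lm (extmod_projective Qp) _.
by rewrite (leq_trans mn) // leq_addr.
Qed.

Local Open Scope ereal_scope.
Local Open Scope classical_set_scope.

(** The set of lengths is empty, where [infimum] returns its default [+oo], or has a least element
    by well-ordering, which is its unique infimum. *)
Lemma resdim_cases (S : comPzRingType) (X : lmodType S -> Prop) N :
  (exists2 n, has_resolution X N n & resdim X N = n%:Z%:E /\
     forall m, has_resolution X N m -> (n <= m)%N) \/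
  (forall n, ~ has_resolution X N n) /\ resdim X N = +oo.
Proof.
rewrite /resdim; set D := [set x | _].
have [[n0 Xn0]|noX] := pselect (exists n, has_resolution X N n); last first.
  right; split=> [n Xn|]; first by case: noX; exists n.
  rewrite /infimum (_ : D = set0) ?eqxx //.
  by apply/seteqP; split=> // x [n Xn _]; case: noX; exists n.
have exn : exists n, `[< has_resolution X N n >] by exists n0; exact/asboolP.
case: (ex_minnP exn) => n /asboolP Xn minn; left; exists n => //.
have {}minn m : has_resolution X N m -> (n <= m)%N by move=> /asboolP/minn.
split=> //; have Dn : D n%:Z%:E by exists n.
have infn : infimums D n%:Z%:E.
  by split=> [x [m /minn nm ->]|x]; [rewrite lee_fin lez_nat|exact].
rewrite /infimum ifN; last by apply/set0P; exists n%:Z%:E.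
apply: xget_unique => // y [lby uby].
by apply/le_anti/andP; split; [exact: lby|apply: uby; exact: infn.1].
Qed.

Lemma resdim_le (S : comPzRingType) (X : lmodType S -> Prop) N n :
  has_resolution X N n -> resdim X N <= n%:Z%:E.
Proof.
move=> Xn; have [[m _ [-> mmin]]|[/(_ n)//]] := resdim_cases X N.
by rewrite lee_fin lez_nat mmin.
Qed.

Lemma has_resolution_resdim (S : comPzRingType) (X : lmodType S -> Prop) N n :
  resdim X N <= n%:Z%:E -> exists2 m, (m <= n)%N & has_resolution X N m.
Proof.
have [[m Xm [-> _]]|[_ ->]] := resdim_cases X N; last by rewrite leye_eq.
by rewrite lee_fin lez_nat => mn; exists m.
Qed.

(** [supremum] is meaningful only where a supremum exists. Here it is the least natural upper bound
    if there is one, and [+oo] otherwise. *)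
Lemma nat_ereal_supremums (D : set (\bar int)) : D !=set0 ->
  (forall x, D x -> x = +oo \/ exists n : nat, x = n%:Z%:E) -> supremums D !=set0.
Proof.
move=> [x0 Dx0] Dnat; have D_ge0 x : D x -> 0 <= x.
  by move=> /Dnat[->|[n ->]]; rewrite ?leey // lee_fin.
(* As [D] has a nonnegative member, negative integers and [-oo] are not upper bounds. *)
have ub_cases y : ubound D y -> y = +oo \/ exists n : nat, y = n%:Z%:E.
  move=> /(_ _ Dx0) /(le_trans (D_ge0 _ Dx0)); case: y => [[n|n]||] //; first by right; exists n.
  by left.
have [[n0 Dn0]|noD] := pselect (exists n : nat, ubound D n%:Z%:E); last first.
  exists +oo; split=> [x _|y /[dup] uby /ub_cases[-> //|[n yn]]]; first exact: leey.
  by case: noD; exists n; rewrite -yn.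
have exn : exists n : nat, `[< ubound D n%:Z%:E >] by exists n0; exact/asboolP.
case: (ex_minnP exn) => n /asboolP Dn minn; exists n%:Z%:E; split=> // y.
move=> /[dup] uby /ub_cases[->|[m ym]]; first exact: leey.
by rewrite ym lee_fin lez_nat; apply: minn; apply/asboolP; rewrite -ym.
Qed.

Lemma Ggldim_supremums (S : comPzRingType) :
  supremums [set x | exists N : lmodType S, x = Gpd N] (Ggldim S).
Proof.
rewrite /Ggldim /supremum; set D := [set x | _].
have D0 : D !=set0 by exists (Gpd (S^o : lmodType S)), S^o.
rewrite ifN; last exact/set0P.
apply: xgetPex; apply: nat_ereal_supremums => // x [N ->].
by have [[n _ [nE _]]|[_ ?]] := resdim_cases (@gproj S) N; [right; exists n|left].
Qed.

Lemma Gpd_le_Ggldim (S : comPzRingType) (N : lmodType S) : Gpd N <= Ggldim S.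
Proof. by apply: (Ggldim_supremums S).1; exists N. Qed.

Lemma Ggldim_le (S : comPzRingType) y :
  (forall N : lmodType S, Gpd N <= y) -> Ggldim S <= y.
Proof. by move=> le_y; apply: (Ggldim_supremums S).2 => _ [N ->]. Qed.

Lemma Ggldim_cases (S : comPzRingType) :
  Ggldim S = +oo \/ exists n : nat, Ggldim S = n%:Z%:E.
Proof.
have := Gpd_le_Ggldim (S^o : lmodType S).
have : 0 <= Gpd (S^o : lmodType S).
  by have [[n _ [nE _]]|[_ nE]] := resdim_cases (@gproj S) S^o; rewrite /Gpd nE ?leey ?lee_fin.
move=> /le_trans h {}/h; case: (Ggldim S) => [[n|n]||] //; last by left.
by right; exists n.
Qed.

End GorensteinDimension.

Theorem theorem2p5 (A : comPzRingType) (E : lmodType A) (r : nat) :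
  (Ggldim A < +oo)%E ->
  fd E = (r%:Z%:E)%E ->
  (Ggldim A <= Ggldim (trivext E) + r%:Z%:E)%E.
Proof.
move=> finA fdE.
have [->|[n nE]] := Ggldim_cases (trivext E); first by rewrite addye ?leey.
have [oo|[m mE]] := Ggldim_cases A; first by rewrite oo in finA.
rewrite nE; apply: Ggldim_le => M.
have resA (N : lmodType A) : exists m, has_resolution (@gproj A) N m.
  have [|j _ Nj] := @has_resolution_resdim A (@gproj A) N m; last by exists j.
  by rewrite -mE; exact: Gpd_le_Ggldim.
have resR (L : lmodType (trivext E)) :
    exists2 j, (j <= n)%N & has_resolution (@gproj (trivext E)) L j.
  by apply: has_resolution_resdim; rewrite -nE; exact: Gpd_le_Ggldim.
(* A finite [fd] is an attained minimum, so [r] is the length of an actual flat resolution. *)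
have Er : has_resolution (@flat A) E r.
  have [[j Ej [jE _]]|[_ oo]] := resdim_cases (@flat A) E.
    by move: fdE; rewrite /fd jE => -[<-].
  by move: fdE; rewrite /fd oo.
rewrite (_ : _ + _ = (r + n)%N%:Z%:E)%E; last by rewrite -EFinD addrC PoszD.
apply/resdim_le/gpd_trivext => // k.
by apply: fd_tor_van Er _; exact: leq_addr.
Qed.
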